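(* Suppose $\mathrm{XXH}(\delta,\zeta,\alpha)$ is true for some constants $\delta,\zeta,\alpha\in(0,1)$ satisfying $\delta\le 10^{-3}$, $\zeta\le\delta^5/10$ and $\alpha\le\delta^{10}$. Then for every $\beta>0$, there is no algorithm that, for any $k$ and $D$, solves exactly the Euclidean $k$-means problem on $n$ points in $\mathbb{R}^D$ in time $n^{(k\sqrt{D})^{1-\beta}}$; nor is there an algorithm that, for any $k$ and $D$, solves it exactly in time $n^{D^{1-\beta}}$.
   Context: Euclidean $k$-means problem: given $n$ points $P\subset\mathbb{R}^D$ and an integer $k$, find a set $\mathcal S\subset\mathbb{R}^D$ of $k$ centers (which may be anywhere in space) minimizing $\mathrm{cost}(P,\mathcal S)=\sum_{p\in P}\min_{s\in\mathcal S}\|p-s\|_2^2$. Small set vertex expander: given $\alpha>0$, a $d$-regular graph $G=(V,E)$ on $n$ vertices and an integer $k=k(n)$, $G$ is a $(k,\alpha)$-small set vertex expander if for every $S\subseteq V$ of size at most $n/k$, $|\{u\in V:\exists \{u,v\}\in E\text{ with }v\in S\}|\ge(1-\alpha)\cdot d\cdot|S|$. Hypothesis $\mathrm{XXH}(\delta,\zeta,\alpha)$ (Exponential Time for Expanders Hypothesis), for constants $\delta,\zeta,\alpha\in(0,1)$: for all $\beta>0$, no randomized algorithm running in $2^{n^{1-\beta}}$ time can, given as input a $d$-regular $(\mathrm{polylog}\, n,\alpha)$-small set vertex expander $G=(V=[n],E)$ with $d=(\log n)^L$ (for some $L>1$), distinguish between the following two cases with probability $0.9$: Completeness: there exist $n/2$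 vertices that cover at least a $(1-\zeta)$ fraction of $E$. Soundness: for every $S\subseteq V$ of size $n/2$, at least $\delta\cdot|E|$ edges are not covered by any vertex in $S$. (An edge is covered by a vertex if that vertex is one of its endpoints.) *)

(* Defs.v *)
From HB Require Import structures.
From mathcomp Require Import all_boot all_order all_algebra.
From mathcomp Require Import all_classical all_reals all_analysis.
Set Implicit Arguments.
Unset Strict Implicit.
Unset Printing Implicit Defensive.
Import Order.TTheory GRing.Theory Num.Theory.
Local Open Scope ring_scope.

(* Programs are structured (while-programs over one infinite integer memory
   with indirect addressing) and evaluating any expression costs one unit plus
   the bit length of its value, in addition to the cost of its operands.  This
   is the logarithmic-cost RAM, polynomially equivalent to Turing machines. *)

Inductive expr : Type :=
| ECst of int
| EMem of expr
| EAdd of expr & expr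
| ESub of expr & expr
| EMul of expr & expr
| EDiv of expr & expr
| ELeq of expr & expr.

Inductive cmd : Type :=
| CSkip
| CAssign of expr & expr  (* [CAssign a e]: M[a] := e *)
| CFlip of expr           (* [CFlip a]: M[a] := a uniformly random bit *)
| CSeq of cmd & cmd
| CIf of expr & cmd & cmd
| CWhile of expr & cmd.

Definition store : Type := int -> int.

Definition upd (s : store) (a v : int) : store :=
  fun b => if b == a then v else s b.

Definition bitlen (z : int) : nat := (trunc_log 2 `|z|%N).+1.

Fixpoint expr_val (e : expr) (s : store) : int :=
  match e with
  | ECst z => z
  | EMem a => s (expr_val a s)
  | EAdd e1 e2 => expr_val e1 s + expr_val e2 s
  | ESub e1 e2 => expr_val e1 s - expr_val e2 s
  | EMul e1 e2 => expr_val e1 s * expr_val e2 s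
  | EDiv e1 e2 => (expr_val e1 s %/ expr_val e2 s)%Z
  | ELeq e1 e2 => ((expr_val e1 s <= expr_val e2 s)%R : nat)%:Z
  end.

Fixpoint expr_cost (e : expr) (s : store) : nat :=
  (match e with
   | ECst _ => 0
   | EMem a => expr_cost a s
   | EAdd e1 e2 | ESub e1 e2 | EMul e1 e2 | EDiv e1 e2 | ELeq e1 e2 =>
       expr_cost e1 s + expr_cost e2 s
   end + (bitlen (expr_val e s)).+1)%N.

(* [exec c s w t s' w']: started in memory [s] with the coin tosses [w] still
   available, [c] halts after time exactly [t] in memory [s'], leaving the
   tosses [w'].  A program that needs a toss when none is left has no
   execution, so an execution started with [w = [::]] is deterministic. *)
Inductive exec : cmd -> store -> seq bool -> nat -> store -> seq bool -> Prop :=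
| ExecSkip s w : exec CSkip s w 1 s w
| ExecAssign a e s w :
    exec (CAssign a e) s w (expr_cost a s + expr_cost e s).+1
      (upd s (expr_val a s) (expr_val e s)) w
| ExecFlip a (b : bool) s w :
    exec (CFlip a) s (b :: w) (expr_cost a s).+1
      (upd s (expr_val a s) (b : nat)%:Z) w
| ExecSeq c1 c2 s1 s2 s3 w1 w2 w3 t1 t2 :
    exec c1 s1 w1 t1 s2 w2 -> exec c2 s2 w2 t2 s3 w3 ->
    exec (CSeq c1 c2) s1 w1 (t1 + t2).+1 s3 w3
| ExecIfTrue e c1 c2 s w s' w' t :
    expr_val e s != 0 -> exec c1 s w t s' w' ->
    exec (CIf e c1 c2) s w (expr_cost e s + t).+1 s' w'
| ExecIfFalse e c1 c2 s w s' w' t :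
    expr_val e s = 0 -> exec c2 s w t s' w' ->
    exec (CIf e c1 c2) s w (expr_cost e s + t).+1 s' w'
| ExecWhileTrue e c s1 s2 s3 w1 w2 w3 t1 t2 :
    expr_val e s1 != 0 -> exec c s1 w1 t1 s2 w2 ->
    exec (CWhile e c) s2 w2 t2 s3 w3 ->
    exec (CWhile e c) s1 w1 (expr_cost e s1 + t1 + t2).+1 s3 w3
| ExecWhileFalse e c s w :
    expr_val e s = 0 -> exec (CWhile e c) s w (expr_cost e s).+1 s w.

(* Input and output words are integer lists: M[0] is the length, followed by
   the entries in M[1], M[2], ...; all other cells are initially 0. *)
Definition load (l : seq int) : store := fun a =>
  if a == 0 then (size l)%:Z else if 0 < a then nth 0 l `|a|%N.-1 else 0.

Definition outputs (s : store) (l : seq int) : Prop :=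
  s 0 = (size l)%:Z /\ forall i : nat, (i < size l)%N -> s i.+1%:Z = nth 0 l i.

Definition input_size (l : seq int) : nat := \sum_(x <- l) bitlen x.

Definition halts_in (A : cmd) (inp : seq int) (T : nat) : Prop :=
  forall w : T.-tuple bool,
    exists t s' w', exec A (load inp) w t s' w' /\ (t <= T)%N.

(* Within time [T] at most [T] coins are tossed, so the probability is taken
   over [T] independent fair coins. *)
Definition prob_output (R : realType) (A : cmd) (inp : seq int) (T : nat)
    (out : seq int) : R :=
  #|[set w : T.-tuple bool |
      `[< exists t s' w', [/\ exec A (load inp) w t s' w', (t <= T)%N
                            & outputs s' out] >] ]|%:R / 2 ^+ T.

Definition simple_graph n (e : rel 'I_n) : Prop := symmetric e /\ irreflexive e.

Definition edges n (e : rel 'I_n) : {set {set 'I_n}} :=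
  [set [set p.1; p.2] | p in [set p : 'I_n * 'I_n | e p.1 p.2]].

Definition regular_graph n (e : rel 'I_n) (d : nat) : Prop :=
  forall u, #|[set v | e u v]| = d.

Definition covered n (e : rel 'I_n) (S : {set 'I_n}) : {set {set 'I_n}} :=
  [set f in edges e | [exists u in S, u \in f]].

(* [#|S| * k <= n] is |S| <= n / k. *)
Definition small_set_expander (R : realType) n (e : rel 'I_n) (d k : nat)
    (alpha : R) : Prop :=
  forall S : {set 'I_n}, (#|S| * k <= n)%N ->
    (1 - alpha) * d%:R * #|S|%:R
      <= #|[set u | [exists v in S, e u v]]|%:R.

Definition log2 (R : realType) (n : nat) : R := ln n%:R / ln 2.

(* The admissible inputs, for the exponent [L] of the degree and an exponent
   [c] bounding polylog n.  As (log n)^L is not an integer in general, [d] is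
   one of its roundings (either one, because n * d has to be even). *)
Definition XXH_instance (R : realType) (alpha L c : R) n (e : rel 'I_n) : Prop :=
  simple_graph e /\
  exists d k : nat,
    [/\ regular_graph e d,
        `| d%:R - log2 R n `^ L | < 1,
        (0 < k)%N /\ k%:R <= log2 R n `^ c
      & small_set_expander e d k alpha].

Definition completeness (R : realType) (zeta : R) n (e : rel 'I_n) : Prop :=
  exists2 S : {set 'I_n}, #|S| = n./2
    & (1 - zeta) * #|edges e|%:R <= #|covered e S|%:R.

Definition soundness (R : realType) (delta : R) n (e : rel 'I_n) : Prop :=
  forall S : {set 'I_n}, #|S| = n./2 ->
    delta * #|edges e|%:R <= #|edges e :\: covered e S|%:R.

Definition encode_graph n (e : rel 'I_n) : seq int :=
  n%:Z :: [seq (e u v : nat)%:Z | u <- enum 'I_n, v <- enum 'I_n].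

(* [A] runs in time 2^(n^(1-beta)) and distinguishes the two cases (output 1
   or 0) with probability 0.9, for each fixed choice of the constants [L] and
   [c] on all admissible graphs with sufficiently many vertices. *)
Definition distinguishes (R : realType) (delta zeta alpha beta : R) (A : cmd) :
    Prop :=
  forall L c : R, 1 < L -> 0 < c ->
  exists n0 : nat, forall n (e : rel 'I_n), (n0 <= n)%N ->
    XXH_instance alpha L c e ->
    let T := Num.truncn (2 `^ (n%:R `^ (1 - beta)) : R) in
    let inp := encode_graph e in
    [/\ halts_in A inp T,
        completeness zeta e -> 9 / 10 <= prob_output R A inp T [:: 1]
      & soundness delta e -> 9 / 10 <= prob_output R A inp T [:: 0]].

Definition XXH (R : realType) (delta zeta alpha : R) : Prop :=
  forall beta : R, 0 < beta ->
    ~ exists A : cmd, distinguishes delta zeta alpha beta A.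

(* A set of [m] points of dimension [D] is given by the [m] distinct rows of a
   matrix. *)

Definition distinct_rows (F : Type) m D (M : 'M[F]_(m, D)) : Prop :=
  injective (fun i => row i M).

Definition sqdist (R : realType) D (x y : 'rV[R]_D) : R :=
  \sum_(j < D) (x 0 j - y 0 j) ^+ 2.

(* The infimum is over a finite set, nonempty for [0 < k]: it is a minimum. *)
Definition kmeans_cost (R : realType) n k D (P : 'M[R]_(n, D))
    (S : 'M[R]_(k, D)) : R :=
  \sum_(i < n) inf (range (fun j : 'I_k => sqdist (row i P) (row j S))).

Definition optimal_centers (R : realType) n k D (P : 'M[R]_(n, D))
    (S : 'M[R]_(k, D)) : Prop :=
  distinct_rows S /\
  forall S' : 'M[R]_(k, D), distinct_rows S' ->
    kmeans_cost P S <= kmeans_cost P S'.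

Definition encode_points m D (M : 'M[rat]_(m, D)) : seq int :=
  flatten [seq [:: numq (M i j); denq (M i j)]
            | i <- enum 'I_m, j <- enum 'I_D].

Definition encode_kmeans n D (P : 'M[rat]_(n, D)) (k : nat) : seq int :=
  [:: n%:Z; k%:Z; D%:Z] ++ encode_points P.

(* [A] deterministically solves every instance of exact k-means with rational
   input points in time [T n k D], up to a factor polynomial in the bit length
   of the input.  The competing centers range over the whole real space; an
   optimal set of centers with rational coordinates always exists. *)
Definition solves_kmeans_in_time (R : realType) (A : cmd)
    (T : nat -> nat -> nat -> R) : Prop :=
  exists C : nat, forall (n k D : nat) (P : 'M[rat]_(n, D)),
    (0 < k <= n)%N -> (0 < D)%N -> distinct_rows P ->
    let inp := encode_kmeans P k in
    exists t s' w' (S : 'M[rat]_(k, D)),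
      [/\ exec A (load inp) [::] t s' w',
          t%:R <= C%:R * (input_size inp)%:R ^+ C * T n k D,
          outputs s' (encode_points S)
        & optimal_centers (map_mx (ratr : rat -> R) P) (map_mx ratr S)].

(* Main.v *)
(* The points of the reduction are the rows of [n^2 I - A], where [A] is the
   adjacency matrix of the d-regular input graph; there are [n] of them, in
   dimension [n], and the number of centers is 2.  For a partition into two
   clusters with centroids as centers the 2-means cost is a constant plus
   [2 n^2 (w(C) / |C| + w(~C) / |~C|)], up to an error [2 d^2] that is negligible
   against [n^2], where [w] counts the ordered pairs of adjacent vertices inside
   a cluster.  Hence, in the completeness case, the optimal partition leaves at
   most [6 zeta d n] ordered pairs inside the clusters, whereas by regularity
   any partition that leaves at most [delta d n / 4] of them can be trimmed, for
   large [n], to a set of [n / 2] vertices contradicting soundness.  The centroid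
   of a cluster has positive coordinates exactly at the vertices of the cluster,
   so the partition can be read off the signs of the first center.  As
   [2 sqrt n] and [n] are both at most [2 n], an algorithm of either kind runs in
   time [n^((2n)^(1-b))] on these instances, which is below [2^(n^(1-b/2))] even
   after polynomial overhead. *)

Require Import Defs.
From mathcomp Require Import all_boot all_order all_algebra.
From mathcomp Require Import all_classical all_reals all_analysis.
From mathcomp Require Import zify ring lra.
Set Implicit Arguments.
Unset Strict Implicit.
Unset Printing Implicit Defensive.
Import Order.TTheory GRing.Theory Num.Theory.
Local Open Scope ring_scope.

(** * Cost and relocation of programs *)

Lemma bitlen_gt0 z : (0 < bitlen z)%N.
Proof. by []. Qed.

Lemma ltn_exp_bitlen z : (`|z| < 2 ^ bitlen z)%N.
Proof. exact: trunc_log_ltn. Qed.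

Lemma bitlen_leq z b : (0 < b)%N -> (`|z| < 2 ^ b)%N -> (bitlen z <= b)%N.
Proof.
move=> b0 zb; rewrite /bitlen; case: (posnP `|z|%N) => [->|z0]; first by [].
by rewrite -(ltn_exp2l _ _ (isT : (1 < 2)%N)) (leq_ltn_trans (trunc_logP _ z0)).
Qed.

Lemma bitlen_mono x y : (`|x| <= `|y|)%N -> (bitlen x <= bitlen y)%N.
Proof. by move=> xy; rewrite ltnS leq_trunc_log. Qed.

Lemma bitlen_leq_abs z : (bitlen z <= `|z|.+1)%N.
Proof.
apply: bitlen_leq => //; apply: (@ltn_trans `|z|.+1) => //.
exact: ltn_expl.
Qed.

Lemma bitlenN z : bitlen (- z) = bitlen z.
Proof. by rewrite /bitlen abszN. Qed.

(** Since every bit length is at least 1, both powers of 2 are at least 2 and their sum is at most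
    their product. The crude bound gives sums and products the same estimate. *)
Lemma bitlenD (x y : int) : (bitlen (x + y) <= bitlen x + bitlen y)%N.
Proof.
apply: bitlen_leq; first by rewrite addn_gt0.
have hx := ltn_exp_bitlen x; have hy := ltn_exp_bitlen y.
have px : (2 <= 2 ^ bitlen x)%N by rewrite expnS leq_pmulr // expn_gt0.
have py : (2 <= 2 ^ bitlen y)%N by rewrite expnS leq_pmulr // expn_gt0.
have hD : (`|(x + y)%R| <= `|x| + `|y|)%N by lia.
rewrite expnD; nia.
Qed.

Lemma bitlenB (x y : int) : (bitlen (x - y) <= bitlen x + bitlen y)%N.
Proof. by rewrite -(bitlenN y) bitlenD. Qed.

Lemma bitlenM (x y : int) : (bitlen (x * y) <= bitlen x + bitlen y)%N.
Proof.
apply: bitlen_leq; first by rewrite addn_gt0.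
have hx := ltn_exp_bitlen x; have hy := ltn_exp_bitlen y.
by rewrite abszM expnD ltn_mul.
Qed.

Lemma bitlen_div x y : (bitlen (x %/ y)%Z <= bitlen x)%N.
Proof. exact/bitlen_mono/lez_div. Qed.

Lemma bitlen_bool (b : bool) : bitlen (b : nat)%:Z = 1%N.
Proof. by case: b. Qed.

Lemma bitlen_lt_cost e s : (bitlen (expr_val e s) < expr_cost e s)%N.
Proof. by case: e => *; exact: leq_addl. Qed.

(** * Bit lengths of memory cells and the cost of fixed expressions *)

Definition cells_le (B : nat) (s : store) : Prop :=
  forall a, (bitlen (s a) <= B)%N.

Lemma cells_le_mono B B' s : (B <= B')%N -> cells_le B s -> cells_le B' s.
Proof. by move=> BB h a; exact: leq_trans BB. Qed.

Lemma cells_le_upd B s a v :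
  cells_le B s -> (bitlen v <= B)%N -> cells_le B (upd s a v).
Proof. by move=> h hv b; rewrite /upd; case: ifP. Qed.

(** Evaluating a value costs more than its bit length, so no cell written within time [t] is longer
    than [t]. This bounds the numbers left behind by an arbitrary solver. *)
Lemma exec_cells_le c s w t s' w' :
  exec c s w t s' w' -> forall B, cells_le B s -> cells_le (maxn B t) s'.
Proof.
elim=> {c s w t s' w'}.
- by move=> s w B; apply: cells_le_mono; rewrite leq_maxl.
- move=> a e s w B h; apply: cells_le_upd.
    by apply: cells_le_mono h; rewrite leq_maxl.
  by rewrite leq_max; have := bitlen_lt_cost e s; lia.
- move=> a b s w B h; apply: cells_le_upd.
    by apply: cells_le_mono h; rewrite leq_maxl.
  by rewrite bitlen_bool leq_max orbT.
- move=> c1 c2 s1 s2 s3 w1 w2 w3 t1 t2 _ h1 _ h2 B /h1/h2.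
  by apply: cells_le_mono; lia.
- move=> e c1 c2 s w s' w' t _ _ h B /h; apply: cells_le_mono; lia.
- move=> e c1 c2 s w s' w' t _ _ h B /h; apply: cells_le_mono; lia.
- move=> e c s1 s2 s3 w1 w2 w3 t1 t2 _ _ h1 _ h2 B /h1/h2.
  by apply: cells_le_mono; lia.
- by move=> e c s w _ B; apply: cells_le_mono; rewrite leq_maxl.
Qed.

(** If all cells have at most [B] bits, values have at most [expr_growth e * B] bits. A cell obeys
    the bound [B] whatever its address, hence the constant 1 for [EMem]. *)
Fixpoint expr_growth (e : expr) : nat :=
  match e with
  | ECst z => bitlen z
  | EMem _ => 1
  | EAdd e1 e2 | ESub e1 e2 | EMul e1 e2 | EDiv e1 e2 | ELeq e1 e2 =>
      expr_growth e1 + expr_growth e2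
  end.

Fixpoint expr_rate (e : expr) : nat :=
  match e with
  | ECst z => (bitlen z).+1
  | EMem a => (expr_rate a).+2
  | EAdd e1 e2 | ESub e1 e2 | EMul e1 e2 | EDiv e1 e2 | ELeq e1 e2 =>
      (expr_rate e1 + expr_rate e2 + (expr_growth e1 + expr_growth e2).+1)%N
  end.

Lemma expr_growth_gt0 e : (0 < expr_growth e)%N.
Proof. by elim: e => //= *; rewrite addn_gt0; apply/orP; left. Qed.

Lemma bitlen_expr_val B e s : (0 < B)%N -> cells_le B s ->
  (bitlen (expr_val e s) <= expr_growth e * B)%N.
Proof.
move=> B0 h; elim: e => [z|a _|e1 h1 e2 h2|e1 h1 e2 h2|e1 h1 e2 h2|e1 h1 e2 h2|
  e1 h1 e2 h2] /=; rewrite ?mulnDl.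
- by rewrite leq_pmulr.
- by rewrite mul1n.
- exact: leq_trans (bitlenD _ _) (leq_add h1 h2).
- exact: leq_trans (bitlenB _ _) (leq_add h1 h2).
- exact: leq_trans (bitlenM _ _) (leq_add h1 h2).
- by rewrite (leq_trans (bitlen_div _ _)) // (leq_trans h1) // leq_addr.
- by rewrite bitlen_bool addn_gt0 muln_gt0 expr_growth_gt0 B0.
Qed.

Lemma expr_cost_leq B e s : (0 < B)%N -> cells_le B s ->
  (expr_cost e s <= expr_rate e * B)%N.
Proof.
move=> B0 h; have hv e0 := @bitlen_expr_val B e0 s B0 h.
elim: e => [z|a ha|e1 h1 e2 h2|e1 h1 e2 h2|e1 h1 e2 h2|e1 h1 e2 h2|e1 h1 e2 h2];
  rewrite [expr_cost _ _]/= [expr_rate _]/=.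
- by rewrite add0n leq_pmulr.
- by have := h (expr_val a s); lia.
- by have := hv (EAdd e1 e2) => /=; lia.
- by have := hv (ESub e1 e2) => /=; lia.
- by have := hv (EMul e1 e2) => /=; lia.
- by have := hv (EDiv e1 e2) => /=; lia.
- by have := hv (ELeq e1 e2) => /=; lia.
Qed.

(** The final store is fixed before the tosses [w], so the result does not depend on them; [T] is
    only an upper bound. *)
Definition runs (c : cmd) (s : store) (T : nat) (s' : store) : Prop :=
  forall w, exists t w', (t <= T)%N /\ exec c s w t s' w'.

Lemma runs_leq c s T T' s' : (T <= T')%N -> runs c s T s' -> runs c s T' s'.
Proof.
move=> TT h w; have [t [w' [tT ex]]] := h w.
by exists t, w'; split=> //; exact: leq_trans TT.
Qed.

Lemma runs_assign B a e s : (0 < B)%N -> cells_le B s ->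
  runs (CAssign a e) s ((expr_rate a + expr_rate e).+1 * B)
    (upd s (expr_val a s) (expr_val e s)).
Proof.
move=> B0 h w; do 2!eexists; split; last exact: ExecAssign.
have := expr_cost_leq a B0 h; have := expr_cost_leq e B0 h; lia.
Qed.

Lemma runs_seq c1 c2 s1 s2 s3 T1 T2 :
  runs c1 s1 T1 s2 -> runs c2 s2 T2 s3 -> runs (CSeq c1 c2) s1 (T1 + T2).+1 s3.
Proof.
move=> h1 h2 w; have [t1 [w1 [l1 e1]]] := h1 w; have [t2 [w2 [l2 e2]]] := h2 w1.
exists (t1 + t2).+1, w2; split; first lia.
exact: ExecSeq e1 e2.
Qed.

Lemma runs_while e c (I : nat -> store -> Prop) N Te Tc s :
  (forall i s, (i < N)%N -> I i s -> [/\ expr_val e s != 0,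
     (expr_cost e s <= Te)%N & exists2 s', runs c s Tc s' & I i.+1 s']) ->
  (forall s, I N s -> expr_val e s = 0 /\ (expr_cost e s <= Te)%N) ->
  I 0%N s ->
  exists2 s', runs (CWhile e c) s (N.+1 * (Te + Tc).+1) s' & I N s'.
Proof.
move=> step stop.
(* Induction on the number [k] of iterations still to come, as the invariant is indexed by those
   already done. The guard is evaluated [k.+1] times. *)
have: forall k i s, (i + k = N)%N -> I i s ->
    exists2 s', runs (CWhile e c) s (k.+1 * (Te + Tc).+1) s' & I N s'.
  elim=> [|k IH] i s0 ik Is.
    have [v0 cT] : expr_val e s0 = 0 /\ (expr_cost e s0 <= Te)%N.
      by apply: stop; rewrite -ik addn0.
    exists s0; last by rewrite -ik addn0.
    move=> w; exists (expr_cost e s0).+1, w; split; first lia.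
    exact: ExecWhileFalse.
  have [v0 cT [s1 r1 I1]] := step i s0 ltac:(lia) Is.
  have [s2 r2 I2] := IH i.+1 s1 ltac:(lia) I1.
  exists s2 => // w; have [t1 [w1 [l1 e1]]] := r1 w; have [t2 [w2 [l2 e2]]] := r2 w1.
  do 2!eexists; split; last exact: ExecWhileTrue v0 e1 e2.
  lia.
by move=> h /(h N 0%N s (add0n N)).
Qed.

Lemma exec_cat c s w t s' w' : exec c s w t s' w' ->
  forall v, exec c s (w ++ v) t s' (w' ++ v).
Proof.
elim=> {c s w t s' w'} *; try by constructor.
- by apply: ExecSeq; eauto.
- by apply: ExecWhileTrue; eauto.
Qed.

(** An execution started without tosses never consumes one, so any supply of tosses can be appended.
    This turns the deterministic solver into a part of a randomized program. *)
Lemma exec_nil_runs c s t s' w' : exec c s [::] t s' w' -> runs c s t s'.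
Proof. by move=> /exec_cat ex w; exists t, (w' ++ w); split=> //; exact: ex. Qed.

(* [a * (2 * a + 1)] is nonnegative and injective on the integers, so a
   program can be confined to a set of negative cells. *)
Definition reloc_addr (a : int) : int := - 3 - a * (2 * a + 1).

(** The difference of two images factors as [a - b] times the odd, hence nonzero, number
    [2 * (a + b) + 1]. *)
Lemma reloc_addr_inj : injective reloc_addr.
Proof.
move=> a b; rewrite /reloc_addr => h.
have : (a - b) * (2 * (a + b) + 1) = 0 by lia.
by move=> /eqP; rewrite mulf_eq0 => /orP[] /eqP; lia.
Qed.

Lemma reloc_addr_le a : reloc_addr a <= - 3.
Proof. rewrite /reloc_addr; nia. Qed.

Definition EReloc (a : expr) : expr :=
  ESub (ECst (- 3)) (EMul a (EAdd (EMul (ECst 2) a) (ECst 1))).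

Lemma expr_val_EReloc a s : expr_val (EReloc a) s = reloc_addr (expr_val a s).
Proof. by []. Qed.

(** The translated address is computed from two copies of [a] and constants, and every intermediate
    bit length is linear in that of [a], which the cost of [a] exceeds; 42 is a generous
    constant. *)
Lemma expr_cost_EReloc a s :
  (expr_cost (EReloc a) s + bitlen (reloc_addr (expr_val a s)) <= 42 * expr_cost a s)%N.
Proof.
rewrite -expr_val_EReloc; have hx := bitlen_lt_cost a s.
have cD e1 e2 : expr_cost (EAdd e1 e2) s = (expr_cost e1 s + expr_cost e2 s +
  (bitlen (expr_val (EAdd e1 e2) s)).+1)%N by [].
have cB e1 e2 : expr_cost (ESub e1 e2) s = (expr_cost e1 s + expr_cost e2 s +
  (bitlen (expr_val (ESub e1 e2) s)).+1)%N by [].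
have cM e1 e2 : expr_cost (EMul e1 e2) s = (expr_cost e1 s + expr_cost e2 s +
  (bitlen (expr_val (EMul e1 e2) s)).+1)%N by [].
have c1 : expr_cost (ECst 1) s = 2%N by [].
have c2 : expr_cost (ECst 2) s = 3%N by [].
have c3 : expr_cost (ECst (- 3)) s = 3%N by [].
have h1 : (bitlen (expr_val (EMul (ECst 2) a) s) <= 2 + bitlen (expr_val a s))%N.
  exact: bitlenM.
have h2 : (bitlen (expr_val (EAdd (EMul (ECst 2) a) (ECst 1)) s) <=
    bitlen (expr_val (EMul (ECst 2) a) s) + 1)%N by exact: bitlenD.
have h3 : (bitlen (expr_val (EMul a (EAdd (EMul (ECst 2) a) (ECst 1))) s) <=
    bitlen (expr_val a s) +
    bitlen (expr_val (EAdd (EMul (ECst 2) a) (ECst 1)) s))%N by exact: bitlenM.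
have h4 : (bitlen (expr_val (EReloc a) s) <=
    2 + bitlen (expr_val (EMul a (EAdd (EMul (ECst 2) a) (ECst 1))) s))%N.
  exact: bitlenB.
rewrite {1}/EReloc cB cM cD cM c1 c2 c3 -/(EReloc a).
have x0 := bitlen_gt0 (expr_val a s).
lia.
Qed.

Fixpoint ereloc (e : expr) : expr :=
  match e with
  | ECst z => ECst z
  | EMem a => EMem (EReloc (ereloc a))
  | EAdd e1 e2 => EAdd (ereloc e1) (ereloc e2)
  | ESub e1 e2 => ESub (ereloc e1) (ereloc e2)
  | EMul e1 e2 => EMul (ereloc e1) (ereloc e2)
  | EDiv e1 e2 => EDiv (ereloc e1) (ereloc e2)
  | ELeq e1 e2 => ELeq (ereloc e1) (ereloc e2)
  end.

Fixpoint creloc (c : cmd) : cmd :=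
  match c with
  | CSkip => CSkip
  | CAssign a e => CAssign (EReloc (ereloc a)) (ereloc e)
  | CFlip a => CFlip (EReloc (ereloc a))
  | CSeq c1 c2 => CSeq (creloc c1) (creloc c2)
  | CIf e c1 c2 => CIf (ereloc e) (creloc c1) (creloc c2)
  | CWhile e c => CWhile (ereloc e) (creloc c)
  end.

Definition simulates (s r : store) : Prop := forall a, r (reloc_addr a) = s a.

Definition same_outside (r r' : store) : Prop :=
  forall b, - 3 < b -> r' b = r b.

Lemma expr_val_ereloc e s r : simulates s r ->
  expr_val (ereloc e) r = expr_val e s.
Proof.
move=> sim; elim: e => //= [a ha|e1 -> e2 ->|e1 -> e2 ->|e1 -> e2 ->|e1 -> e2 ->|
  e1 -> e2 ->] //.
by rewrite ha -/(reloc_addr _) sim.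
Qed.

(** Each memory access multiplies the factor of its address by 42: the slowdown may be exponential
    in the nesting depth, but it is constant for a fixed program. *)
Fixpoint ereloc_rate (e : expr) : nat :=
  match e with
  | ECst _ => 1
  | EMem a => (42 * ereloc_rate a).+1
  | EAdd e1 e2 | ESub e1 e2 | EMul e1 e2 | EDiv e1 e2 | ELeq e1 e2 =>
      (ereloc_rate e1 + ereloc_rate e2).+1
  end.

Fixpoint creloc_rate (c : cmd) : nat :=
  match c with
  | CSkip => 1
  | CAssign a e => (42 * ereloc_rate a + ereloc_rate e).+1
  | CFlip a => (42 * ereloc_rate a).+1
  | CSeq c1 c2 => (creloc_rate c1 + creloc_rate c2).+1
  | CIf e c1 c2 => (ereloc_rate e + creloc_rate c1 + creloc_rate c2).+1
  | CWhile e c => (ereloc_rate e + creloc_rate c).+1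
  end.

Lemma expr_cost_ereloc e s r : simulates s r ->
  (expr_cost (ereloc e) r <= ereloc_rate e * expr_cost e s)%N.
Proof.
move=> sim; have hv e0 := @expr_val_ereloc e0 s r sim.
have bin e1 e2 (v v' : int) : v' = v ->
    (expr_cost (ereloc e1) r <= ereloc_rate e1 * expr_cost e1 s)%N ->
    (expr_cost (ereloc e2) r <= ereloc_rate e2 * expr_cost e2 s)%N ->
    (expr_cost (ereloc e1) r + expr_cost (ereloc e2) r + (bitlen v').+1 <=
     (ereloc_rate e1 + ereloc_rate e2).+1 *
     (expr_cost e1 s + expr_cost e2 s + (bitlen v).+1))%N.
  by move=> -> h1 h2; nia.
elim: e => [z|a ha|e1 h1 e2 h2|e1 h1 e2 h2|e1 h1 e2 h2|e1 h1 e2 h2|e1 h1 e2 h2].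
- by rewrite /= mul1n.
- have := expr_cost_EReloc (ereloc a) r; have := hv (EMem a).
  rewrite [expr_cost (ereloc (EMem a)) r]/= -/(expr_cost (EReloc _) r).
  rewrite [expr_val (ereloc (EMem a)) r]/= => ->.
  rewrite [expr_cost (EMem a) s]/= [ereloc_rate (EMem a)]/= -/(EReloc (ereloc a)).
  set X := expr_cost (EReloc _) r => h.
  have : (X <= 42 * expr_cost (ereloc a) r)%N by lia.
  by rewrite /X /= => {h}; nia.
- exact: bin (hv (EAdd e1 e2)) h1 h2.
- exact: bin (hv (ESub e1 e2)) h1 h2.
- exact: bin (hv (EMul e1 e2)) h1 h2.
- exact: bin (hv (EDiv e1 e2)) h1 h2.
- exact: bin (hv (ELeq e1 e2)) h1 h2.
Qed.

Lemma simulates_upd s r a v : simulates s r ->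
  simulates (upd s a v) (upd r (reloc_addr a) v).
Proof. by move=> sim b; rewrite /upd (inj_eq reloc_addr_inj) sim. Qed.

Lemma same_outside_upd r a v : same_outside r (upd r (reloc_addr a) v).
Proof.
by move=> b hb; rewrite /upd; case: eqP => // E; have := reloc_addr_le a; lia.
Qed.

Lemma same_outside_trans r1 r2 r3 :
  same_outside r1 r2 -> same_outside r2 r3 -> same_outside r1 r3.
Proof. by move=> h1 h2 b hb; rewrite h2 // h1. Qed.

(** Induction on the execution. The frame condition [same_outside] is what keeps the input graph and
    the work cells intact while the solver runs. *)
Lemma creloc_exec c s w t s' w' : exec c s w t s' w' ->
  forall r, simulates s r -> exists t' r',
    [/\ exec (creloc c) r w t' r' w', (t' <= creloc_rate c * t)%N,
        simulates s' r' & same_outside r r'].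
Proof.
elim=> {c s w t s' w'}.
- by move=> s w r sim; exists 1%N, r; split=> //; exact: ExecSkip.
- move=> a e s w r sim; do 2!eexists; split.
  + exact: ExecAssign.
  + have := expr_cost_EReloc (ereloc a) r; have := expr_cost_ereloc a sim.
    have := expr_cost_ereloc e sim; rewrite [creloc_rate _]/=; nia.
  + rewrite expr_val_EReloc !(expr_val_ereloc _ sim); exact: simulates_upd.
  + by rewrite expr_val_EReloc; exact: same_outside_upd.
- move=> a b s w r sim; do 2!eexists; split.
  + exact: ExecFlip.
  + have := expr_cost_EReloc (ereloc a) r; have := expr_cost_ereloc a sim.
    rewrite [creloc_rate _]/=; nia.
  + rewrite expr_val_EReloc !(expr_val_ereloc _ sim); exact: simulates_upd.
  + by rewrite expr_val_EReloc; exact: same_outside_upd.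
- move=> c1 c2 s1 s2 s3 w1 w2 w3 t1 t2 _ h1 _ h2 r sim.
  have [t1' [r1 [e1 l1 sim1 o1]]] := h1 r sim.
  have [t2' [r2 [e2 l2 sim2 o2]]] := h2 r1 sim1.
  do 2!eexists; split.
  + exact: ExecSeq e1 e2.
  + rewrite [creloc_rate _]/=; nia.
  + exact: sim2.
  + exact: same_outside_trans o1 o2.
- move=> e c1 c2 s w s' w' t v0 _ h r sim.
  have [t' [r' [ex l sim' o]]] := h r sim.
  exists (expr_cost (ereloc e) r + t').+1, r'; split=> //.
  + by apply: ExecIfTrue ex; rewrite (expr_val_ereloc _ sim).
  + have := expr_cost_ereloc e sim; rewrite [creloc_rate _]/=; nia.
- move=> e c1 c2 s w s' w' t v0 _ h r sim.
  have [t' [r' [ex l sim' o]]] := h r sim.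
  exists (expr_cost (ereloc e) r + t').+1, r'; split=> //.
  + by apply: ExecIfFalse ex; rewrite (expr_val_ereloc _ sim).
  + have := expr_cost_ereloc e sim; rewrite [creloc_rate _]/=; nia.
- move=> e c s1 s2 s3 w1 w2 w3 t1 t2 v0 _ h1 _ h2 r sim.
  have [t1' [r1 [e1 l1 sim1 o1]]] := h1 r sim.
  have [t2' [r2 [e2 l2 sim2 o2]]] := h2 r1 sim1.
  exists (expr_cost (ereloc e) r + t1' + t2').+1, r2; split=> //.
  + by apply: ExecWhileTrue e1 e2; rewrite (expr_val_ereloc _ sim).
  + move: l2; have := expr_cost_ereloc e sim; rewrite [creloc_rate _]/=; nia.
  + exact: same_outside_trans o1 o2.
- move=> e c s w v0 r sim.
  exists (expr_cost (ereloc e) r).+1, r; split=> //.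
  + by apply: ExecWhileFalse; rewrite (expr_val_ereloc _ sim).
  + have := expr_cost_ereloc e sim; rewrite [creloc_rate _]/=; nia.
Qed.

(** * Bipartitions of regular graphs *)

Definition within n (e : rel 'I_n) (B : {set 'I_n}) : nat :=
  \sum_(u in B) \sum_(v in B) e u v.

Definition degree_into n (e : rel 'I_n) (B : {set 'I_n}) (u : 'I_n) : nat :=
  \sum_(v in B) e u v.

Section Graphs.
Variables (n : nat) (e : rel 'I_n) (d : nat).
Hypotheses (e_simple : simple_graph e) (e_reg : regular_graph e d).
Implicit Types B C S : {set 'I_n}.

Lemma sum_neighbours u : (\sum_v e u v)%N = d.
Proof. by rewrite -(e_reg u) -sum1dep_card -big_mkcond. Qed.

Lemma degree_into_leq B u : (degree_into e B u <= d)%N.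
Proof.
rewrite -(sum_neighbours u) /degree_into [X in (_ <= X)%N](bigID (mem B)) /=.
exact: leq_addr.
Qed.

Lemma sum_degree_into_leq B C :
  (\sum_(u in B) degree_into e C u <= d * #|B|)%N.
Proof.
rewrite mulnC -sum_nat_const; apply: leq_sum => u _; exact: degree_into_leq.
Qed.

Lemma sum_degree_intoC B C :
  (\sum_(u in B) degree_into e C u = \sum_(u in C) degree_into e B u)%N.
Proof.
rewrite /degree_into exchange_big /=.
by apply: eq_bigr => u _; apply: eq_bigr => v _; rewrite (proj1 e_simple).
Qed.

Lemma degree_into_setCr B u : (degree_into e B u + degree_into e (~: B) u)%N = d.
Proof.
rewrite -(sum_neighbours u) [RHS](bigID (mem B)) /=; congr addn.
by apply: eq_bigl => v; rewrite inE.
Qed.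

Lemma within_cut B :
  (within e B + \sum_(u in B) degree_into e (~: B) u)%N = (d * #|B|)%N.
Proof.
rewrite /within -big_split /= mulnC -sum_nat_const.
by apply: eq_bigr => u _; exact: degree_into_setCr.
Qed.

(** Both sides of a bipartition see the same cut, so subtracting the two instances of [within_cut]
    eliminates it. *)
Lemma within_balance B :
  (within e B + d * #|~: B| = within e (~: B) + d * #|B|)%N.
Proof.
rewrite -(within_cut B) -(within_cut (~: B)) finset.setCK sum_degree_intoC; lia.
Qed.

Lemma card_edges_within B :
  (#|[set f in edges e | f \subset B]| * 2)%N = within e B.
Proof.
have [e_sym e_irr] := e_simple.
(* [L] keeps the increasing orientation of each edge, which makes the passage to unordered pairs
   injective; the decreasing orientations account for the factor 2. *)
pose L := [set p : 'I_n * 'I_n | [&& p.1 \in B, p.2 \in B & e p.1 p.2 && (p.1 < p.2)%N]].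
have -> : [set f in edges e | f \subset B] = [set [set p.1; p.2] | p in L].
  apply/finset.setP => f; rewrite inE; apply/andP/imsetP => [[]|].
    case/imsetP => -[u v]; rewrite inE /= => euv -> /fintype.subsetP sub.
    have uB : u \in B by apply: sub; rewrite !inE eqxx.
    have vB : v \in B by apply: sub; rewrite !inE eqxx orbT.
    have [uv|vu|/val_inj uv] := ltngtP u v.
    - by exists (u, v); rewrite // inE /= uB vB euv uv.
    - by exists (v, u); [rewrite inE /= uB vB e_sym euv vu | exact: finset.setUC].
    - by rewrite uv e_irr in euv.
  case=> -[u v]; rewrite inE /= => /and4P[uB vB euv _] ->; split.
    by apply/imsetP; exists (u, v); rewrite ?inE.
  by apply/fintype.subsetP => w; rewrite !inE => /orP[] /eqP ->.
rewrite card_in_imset; last first.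
  case=> u v [u' v']; rewrite !inE /= => /and4P[_ _ _ uv] /and4P[_ _ _ uv'] E.
  have hE w : (w \in [set u; v]) = (w \in [set u'; v']) by rewrite E.
  have := hE u; have := hE v; have := hE u'; have := hE v'.
  rewrite !inE !eqxx !orbT /= -!val_eqE /= => h1 h2 h3 h4.
  by congr pair; apply: val_inj => /=; lia.
have cardL : #|L| = (\sum_(u in B) \sum_(v in B) (e u v && (u < v)))%N.
  rewrite pair_big_dep /= -sum1dep_card big_mkcond [RHS]big_mkcond /=.
  by apply: eq_bigr => -[u v] _ /=; case: (u \in B) => //; case: (v \in B).
rewrite muln2 -addnn {1}cardL.
have -> : #|L| = (\sum_(u in B) \sum_(v in B) (e u v && (v < u)))%N.
  rewrite cardL exchange_big /=; apply: eq_bigr => u _; apply: eq_bigr => v _.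
  by rewrite e_sym.
rewrite /within -big_split /=; apply: eq_bigr => u _.
rewrite -big_split /=; apply: eq_bigr => v _.
case: (ltngtP u v) => [_|_|/val_inj ->]; rewrite ?andbT ?andbF ?addn0 //.
by rewrite e_irr.
Qed.

Lemma within_setT : within e [set: 'I_n] = (d * n)%N.
Proof.
have := within_cut [set: 'I_n]; rewrite cardsT card_ord => <-.
rewrite big1 ?addn0 // => u _; rewrite /degree_into big1 // => v.
by rewrite !inE.
Qed.

Lemma card_edges : (#|edges e| * 2)%N = (d * n)%N.
Proof.
rewrite -within_setT -card_edges_within; congr (_ * 2)%N.
by apply: eq_card => f; rewrite [RHS]inE finset.subsetT andbT.
Qed.

Lemma uncovered_within S :
  (#|edges e :\: covered e S| * 2)%N = within e (~: S).
Proof.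
rewrite -card_edges_within; congr (_ * 2)%N; apply: eq_card => f.
rewrite !inE; case: (f \in edges e); rewrite ?andbF //= andbT.
apply/idP/idP.
  move=> /existsP h; apply/fintype.subsetP => u uf; rewrite inE; apply/negP => uS.
  by apply: h; exists u; rewrite uS.
move=> /fintype.subsetP h; apply/existsP => -[u /andP[uS /h]].
by rewrite inE uS.
Qed.

Lemma covered_within S :
  (#|covered e S| * 2 + within e (~: S))%N = (d * n)%N.
Proof.
rewrite -uncovered_within -card_edges -mulnDl; congr (_ * 2)%N.
rewrite -(cardsID (covered e S) (edges e)); congr (_ + _)%N.
by apply: eq_card => f; rewrite !inE; case: (f \in edges e).
Qed.

(** Moving [B :\: S] across creates at most [2 * d * #|B :\: S|] new pairs, while by
    [within_balance] the complement of [B] starts with [d * (#|B| - #|~: B|)] fewer pairs than [B].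
    The two cancel up to [d * odd n], whence the [d] in the bound. *)
Lemma trim_bipartition B : (n./2 <= #|B|)%N ->
  exists2 S : {set 'I_n}, #|S| = n./2 & (within e (~: S) <= within e B + d)%N.
Proof.
move=> /card_geqP[s [s_uniq s_size /fintype.subsetP sB]].
pose S := [set u in s].
have SB : S \subset B by apply/fintype.subsetP => u; rewrite inE => /(fintype.subsetP sB).
have cardS : #|S| = n./2 by rewrite cardsE -s_size; apply/card_uniqP.
exists S => //.
have split_sum (F : 'I_n -> nat) :
    (\sum_(u in ~: S) F u = \sum_(u in ~: B) F u + \sum_(u in B :\: S) F u)%N.
  rewrite (bigID (mem B)) /= addnC; congr addn; apply: eq_bigl => u.
    by rewrite !inE; case: (boolP (u \in B)) => uB; rewrite ?andbF // andbT;
      apply/negP => us; case/negP: uB; apply: (fintype.subsetP SB); rewrite inE.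
  by rewrite !inE.
have cardBS : (#|B :\: S| + n./2 = #|B|)%N.
  by rewrite -cardS cardsDS // subnK // subset_leq_card.
(* A new pair has its first or its second end among the moved vertices; each case gives at most [d]
   pairs per moved vertex. *)
have le1 : (within e (~: S) <= within e (~: B) + 2 * d * #|B :\: S|)%N.
  have -> : within e (~: S) = (\sum_(u in ~: S) degree_into e (~: S) u)%N by [].
  rewrite split_sum.
  have -> : (\sum_(u in ~: B) degree_into e (~: S) u =
      within e (~: B) + \sum_(u in ~: B) degree_into e (B :\: S) u)%N.
    by rewrite /within -big_split /=; apply: eq_bigr => u _; exact: split_sum.
  rewrite (sum_degree_intoC (~: B) (B :\: S)).
  have := sum_degree_into_leq (B :\: S) (~: B).
  have := sum_degree_into_leq (B :\: S) (~: S).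
  lia.
have cardC : (#|B| + #|~: B| = n)%N by rewrite cardsC card_ord.
have hC : (#|~: B| + #|B :\: S| = odd n + n./2)%N.
  have := odd_double_half n; lia.
have hd : (d * #|~: B| + d * #|B :\: S| = d * odd n + d * n./2)%N.
  by rewrite -!mulnDr hC.
have hB : (d * #|B| = d * #|B :\: S| + d * n./2)%N by rewrite -mulnDr cardBS.
have : (d * odd n <= d)%N by case: (odd n); rewrite ?muln1 ?muln0.
have := within_balance B; lia.
Qed.

End Graphs.

(** Trimming the larger side would leave at most [delta * d * n / 4 + d] ordered pairs uncovered. As
    [d < delta * d * n / 2], this is less than the [delta * d * n] required by soundness. *)
Lemma soundness_within (R : realType) (delta : R) n (e : rel 'I_n) (d q : nat) B :
  simple_graph e -> regular_graph e d -> (0 < d)%N ->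
  0 < delta -> 4 / delta <= q%:R -> 2 / delta < n%:R -> soundness delta e ->
  ~ (q * (within e B + within e (~: B)) <= d * n)%N.
Proof.
move=> es er d0 delta0 hq hn snd.
wlog hB : B / (n./2 <= #|B|)%N.
  move=> main; case: (leqP n./2 #|B|) => [|hB]; first exact: main.
  rewrite addnC -{2}(finset.setCK B); apply: main.
  have := cardsC B; rewrite card_ord; have := odd_double_half n; lia.
have [S cardS wS] := trim_bipartition es er hB.
move=> hle; have := snd S cardS.
have /(congr1 (fun k => k%:R : R)) := card_edges es er.
have /(congr1 (fun k => k%:R : R)) := uncovered_within es S.
rewrite !natrM; set x := (#|_|%:R : R); set y := (#|_|%:R : R) => hx hy h.
have wS' : (within e (~: S))%:R <= (within e B)%:R + d%:R :> R.
  by rewrite -natrD ler_nat.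
have hle' : q%:R * (within e B)%:R <= d%:R * n%:R :> R.
  by rewrite -!natrM ler_nat; lia.
have d0' : 0 < d%:R :> R by rewrite ltr0n.
have W0 : 0 <= (within e B)%:R :> R by [].
move: hq hn; rewrite ler_pdivrMr // ltr_pdivrMr // => hq hn.
nra.
Qed.

(** * Two-means clustering *)

Definition cluster_sum (R : realType) n D (X : 'M[R]_(n, D)) (C : {set 'I_n})
    (j : 'I_D) : R := \sum_(u in C) X u j.

Definition centroid (R : realType) n D (X : 'M[R]_(n, D)) (C : {set 'I_n}) :
    'rV[R]_D := \row_j (cluster_sum X C j / #|C|%:R).

(** This is the size of the cluster times the squared norm of its centroid: the saving over the sum
    of squared norms when the centroid is the center. It is 0 for the empty cluster. *)
Definition gain (R : realType) n D (X : 'M[R]_(n, D)) (C : {set 'I_n}) : R :=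
  (\sum_j cluster_sum X C j ^+ 2) / #|C|%:R.

Lemma sqdist_ge0 (R : realType) D (x y : 'rV[R]_D) : 0 <= sqdist x y.
Proof. by apply: sumr_ge0 => j _; exact: sqr_ge0. Qed.

Lemma sqdist_eq0 (R : realType) D (x y : 'rV[R]_D) :
  sqdist x y = 0 -> x = y.
Proof.
move=> /eqP; rewrite psumr_eq0; last by move=> j _; exact: sqr_ge0.
move=> /allP h; apply/rowP => j; have := h j (mem_index_enum j).
by rewrite sqrf_eq0 subr_eq0 => /eqP.
Qed.

Section TwoMeans.
Variables (R : realType) (n D : nat) (X : 'M[R]_(n, D)).
Implicit Types (B C : {set 'I_n}) (S : 'M[R]_(2, D)).

(* The division by [#|C| = 0] is harmless: all terms vanish for [C = set0]. *)
Lemma cluster_cost C (s : 'rV[R]_D) :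
  \sum_(u in C) sqdist (row u X) s =
  \sum_(u in C) \sum_j X u j ^+ 2 - gain X C + #|C|%:R * sqdist s (centroid X C).
Proof.
rewrite /gain /sqdist exchange_big /= [in X in X - _]exchange_big /=.
rewrite mulr_suml mulr_sumr -sumrB -big_split /=; apply: eq_bigr => j _.
rewrite !mxE; under eq_bigr => u _ do rewrite !mxE sqrrB.
rewrite !big_split /= sumrN sumr_const -mulr_natr.
have -> : \sum_(u in C) X u j * s 0 j *+ 2 = (cluster_sum X C j * s 0 j) *+ 2.
  by rewrite sumrMnl -mulr_suml.
case: (eqVneq #|C| 0%N) => [C0|Cn0].
  rewrite /cluster_sum (cards0_eq C0) !big_set0 cards0; ring.
have : #|C|%:R != 0 :> R by rewrite pnatr_eq0.
by move=> h; field.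
Qed.

Definition two_cost B (S : 'M[R]_(2, D)) : R :=
  \sum_(u in B) sqdist (row u X) (row 0 S) +
  \sum_(u in ~: B) sqdist (row u X) (row 1 S).

Lemma two_costE B S : two_cost B S =
  \sum_u \sum_j X u j ^+ 2 - gain X B - gain X (~: B) +
  #|B|%:R * sqdist (row 0 S) (centroid X B) +
  #|~: B|%:R * sqdist (row 1 S) (centroid X (~: B)).
Proof.
rewrite /two_cost !cluster_cost [\sum_u _](bigID (mem B)) /=.
under [X in _ = _ + X - _ - _ + _ + _]eq_bigl => u do rewrite -finset.in_setC.
ring.
Qed.

Lemma inf_ord2 (f : 'I_2 -> R) : inf (range f) = Num.min (f 0) (f 1).
Proof.
have lbf : lbound (range f) (Num.min (f 0) (f 1)).
  move=> _ [i _ <-]; rewrite ge_min.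
  by case: i => -[|[|//]] i2; apply/orP; [left|right];
    rewrite le_eqVlt; apply/orP; left; apply/eqP; congr f; apply: val_inj.
apply/eqP; rewrite eq_le; apply/andP; split.
  by rewrite le_min; apply/andP; split; apply: ge_inf; try (by exists (Num.min (f 0) (f 1)));
    eexists.
by apply: lb_le_inf => //; exists (f 0); exists 0.
Qed.

Lemma kmeans_cost_le_two_cost B S : kmeans_cost X S <= two_cost B S.
Proof.
rewrite /kmeans_cost /two_cost (bigID (mem B)) /=; apply: lerD.
  by apply: ler_sum => u _; rewrite inf_ord2 ge_min lexx.
rewrite [leRHS](eq_bigl (fun u => u \notin B)) => [|u]; last by rewrite inE.
by apply: ler_sum => u _; rewrite inf_ord2 ge_min lexx orbT.
Qed.

Lemma kmeans_cost_two_cost S : exists C, kmeans_cost X S = two_cost C S.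
Proof.
exists [set u | sqdist (row u X) (row 0 S) <= sqdist (row u X) (row 1 S)].
rewrite /kmeans_cost /two_cost (bigID [in [set u |
  sqdist (row u X) (row 0 S) <= sqdist (row u X) (row 1 S)]]) /=.
congr (_ + _).
  by apply: eq_bigr => u; rewrite inE inf_ord2 => h; rewrite min_l.
rewrite [RHS](eq_bigl (fun u => u \notin [set u |
  sqdist (row u X) (row 0 S) <= sqdist (row u X) (row 1 S)])) => [|u]; last by rewrite !inE.
by apply: eq_bigr => u; rewrite inE inf_ord2 -ltNge => /ltW h; rewrite min_r.
Qed.

(** The competitors are the two centroids of a bipartition [B]; their being different makes them
    admissible as distinct rows. The distance term of the first center is kept because [B := C] then
    forces it to vanish. *)
Lemma optimal_centers_gain S : optimal_centers X S -> exists C,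
  forall B, centroid X B != centroid X (~: B) ->
  gain X B + gain X (~: B) + #|C|%:R * sqdist (row 0 S) (centroid X C)
    <= gain X C + gain X (~: C).
Proof.
case=> _ opt; have [C costC] := kmeans_cost_two_cost S.
exists C => B hB.
pose S' : 'M[R]_(2, D) := \matrix_(i, j)
  (if i == 0 then centroid X B 0 j else centroid X (~: B) 0 j).
have r0 : row 0 S' = centroid X B by apply/rowP => j; rewrite !mxE eqxx.
have r1 : row 1 S' = centroid X (~: B) by apply/rowP => j; rewrite !mxE.
have dS' : distinct_rows S'.
  move=> i j; have ord2 (k : 'I_2) : k = 0 \/ k = 1.
    by case: k => -[|[|//]] k2; [left|right]; apply: val_inj.
  case: (ord2 i) => ->; case: (ord2 j) => -> //; rewrite r0 r1 => E.
    by rewrite E eqxx in hB.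
  by rewrite E eqxx in hB.
have := le_trans (opt S' dS') (kmeans_cost_le_two_cost B S').
have sq0 (x : 'rV[R]_D) : sqdist x x = 0.
  by apply: big1 => j _; rewrite subrr expr0n.
rewrite costC !two_costE r0 r1 !sq0 !mulr0 !addr0.
have := sqdist_ge0 (row 1 S) (centroid X (~: C)).
have : 0 <= #|~: C|%:R :> R by [].
set c := #|~: C|%:R; set x := sqdist (row 1 S) _ => c0 x0.
have := mulr_ge0 c0 x0; lra.
Qed.

End TwoMeans.

(** * The points of a graph *)

(** The rounded half is at least 2/5 of [n], with equality at [n = 5]. *)
Lemma half_split n t t' : (5 <= n)%N -> t = n./2 -> (t + t' = n)%N ->
  [/\ 0 < t, 0 < t', 2 * n <= 5 * t & t <= t']%N.
Proof. by move=> n5 -> E; have := odd_double_half n; split; lia. Qed.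

(** Generic in the ring: the rational matrix is the input of the solver, the real one is used for
    the cost estimates. *)
Definition graph_points (F : nzRingType) (lam : F) n (e : rel 'I_n) : 'M[F]_n :=
  \matrix_(u, v) (lam *+ (u == v) - (e u v)%:R).

Section GraphPoints.
Variables (R : realType) (n : nat) (e : rel 'I_n) (d : nat) (lam : R).
Hypotheses (e_simple : simple_graph e) (e_reg : regular_graph e d).
Hypothesis (lam_gt : d%:R < lam).
Implicit Types B C : {set 'I_n}.
Let X := graph_points lam e.

Lemma cluster_sum_graph_points C j :
  cluster_sum X C j = lam *+ (j \in C) - (degree_into e C j)%:R.
Proof.
rewrite /cluster_sum; under eq_bigr => u _ do rewrite mxE.
rewrite big_split /= sumrN /degree_into natr_sum; congr (_ - _).
  case: (boolP (j \in C)) => jC.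
    by rewrite (bigD1 j) //= eqxx big1 ?addr0 // => u /andP[_ /negbTE ->].
  by apply: big1 => u uC; case: eqP uC jC => // -> ->.
by apply: eq_bigr => u _; rewrite (proj1 e_simple).
Qed.

(** Coordinate [u] of the cluster sum is [lam] minus a degree at most [d < lam] if [u] is in [C],
    and minus a degree otherwise. *)
Lemma centroid_graph_points_gt0 C u :
  (0 < centroid X C 0 u) = (u \in C).
Proof.
rewrite mxE cluster_sum_graph_points.
have hd : (degree_into e C u)%:R <= d%:R :> R.
  by rewrite ler_nat (degree_into_leq e_reg).
case: (boolP (u \in C)) => uC.
  rewrite divr_gt0 // ?mulr1n ?subr_gt0 ?(le_lt_trans hd) //.
  by rewrite ltr0n; apply/card_gt0P; exists u.
by rewrite mulr0n sub0r mulNr oppr_gt0 ltNge divr_ge0.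
Qed.

Lemma centroid_graph_points_neq B : (0 < #|B|)%N ->
  centroid X B != centroid X (~: B).
Proof.
move=> /card_gt0P[u uB]; apply/eqP => E.
have := centroid_graph_points_gt0 B u; rewrite E centroid_graph_points_gt0.
by rewrite inE uB.
Qed.

Definition density C : R := (within e C)%:R / #|C|%:R.

(** One factor of each square is at most [d]; the remaining degrees sum to [d * #|C|] by double
    counting. *)
Lemma sum_sqr_degree_leq C :
  (\sum_j degree_into e C j ^ 2 <= d ^ 2 * #|C|)%N.
Proof.
apply: (@leq_trans (\sum_j d * degree_into e C j)).
  by apply: leq_sum => j _; rewrite -mulnn leq_mul2r (degree_into_leq e_reg) orbT.
rewrite -big_distrr /= /degree_into exchange_big /= -mulnn -mulnA leq_mul2l.
apply/orP; right; rewrite mulnC -sum_nat_const; apply: leq_sum => u _.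
rewrite -(sum_neighbours e_reg u); apply: eq_leq.
by apply: eq_bigr => v _; rewrite (proj1 e_simple).
Qed.

(** In the squared coordinates of the cluster sum, [lam ^+ 2] occurs once per vertex of [C], the
    cross terms add up to [2 * lam * within e C], and the squared degrees form the error. *)
Lemma gain_graph_points C : (0 < #|C|)%N ->
  lam ^+ 2 - 2 * lam * density C <= gain X C
    <= lam ^+ 2 - 2 * lam * density C + d%:R ^+ 2.
Proof.
move=> C0; have m0 : 0 < #|C|%:R :> R by rewrite ltr0n.
have -> : gain X C = lam ^+ 2 - 2 * lam * density C +
    (\sum_j degree_into e C j ^ 2)%N%:R / #|C|%:R.
  rewrite /gain; under [in LHS]eq_bigr => j _ do
    rewrite cluster_sum_graph_points sqrrB -natrX.
  rewrite big_split /= -natr_sum mulrDl; congr (_ + _).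
  rewrite sumrB.
  have -> : \sum_i (lam *+ (i \in C)) ^+ 2 = lam ^+ 2 * #|C|%:R.
    rewrite mulr_natr -sumr_const [RHS]big_mkcond /=.
    by apply: eq_bigr => j _; case: (j \in C); rewrite ?expr0n.
  have -> : \sum_i lam *+ (i \in C) * (degree_into e C i)%:R *+ 2 =
      2 * lam * (within e C)%:R.
    rewrite sumrMnl -[LHS]mulr_natl -mulrA; congr (_ * _).
    rewrite /within natr_sum mulr_sumr [RHS]big_mkcond /=; apply: eq_bigr => j _.
    by case: (j \in C); rewrite ?mul0r.
  by rewrite /density; field; rewrite gt_eqF.
rewrite lerDl divr_ge0 //= lerD2l ler_pdivrMr //.
by rewrite -natrX -natrM ler_nat sum_sqr_degree_leq.
Qed.

Lemma density_ge0 C : 0 <= density C.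
Proof. exact: divr_ge0. Qed.

Lemma gain_graph_points_leq C : gain X C <= lam ^+ 2 + d%:R ^+ 2.
Proof.
have lam0 : 0 <= lam by apply: le_trans (ltW lam_gt).
have [C0|C0] := posnP #|C|.
  by rewrite /gain C0 invr0 mulr0 addr_ge0 // sqr_ge0.
have [_] := andP (gain_graph_points C0).
have := mulr_ge0 lam0 (density_ge0 C); lra.
Qed.

Lemma within_density C : (within e C)%:R <= n%:R * density C.
Proof.
have [C0|C0] := posnP #|C|.
  have -> : within e C = 0%N.
    by rewrite /within (cards0_eq C0) big_set0.
  by rewrite mulr_ge0 // density_ge0.
have m0 : 0 < #|C|%:R :> R by rewrite ltr0n.
rewrite /density mulrCA ler_peMr // ler_pdivlMr // mul1r ler_nat.
by rewrite -[X in (_ <= X)%N]card_ord max_card.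
Qed.

(** The optimal bipartition is compared with the cover [T] and its complement. An upper bound on its
    densities follows once both of its clusters are known to be nonempty. *)
Lemma optimal_2means_within (zeta : R) (S : 'M[R]_(2, n)) :
  (5 <= n)%N -> (0 < d)%N -> 0 < zeta < 1 / 10 -> d%:R <= zeta * lam ->
  completeness zeta e -> optimal_centers X S ->
  exists C : {set 'I_n}, (forall u, (0 < S 0 u) = (u \in C)) /\
    (within e C)%:R + (within e (~: C))%:R <= 6 * zeta * d%:R * n%:R :> R.
Proof.
move=> n5 d0 /andP[z0 z1] hd [T cardT covT] optS.
have d0' : 0 < d%:R :> R by rewrite ltr0n.
have lam0 : 0 < lam by apply: lt_trans lam_gt.
have n0 : 0 < n%:R :> R by rewrite ltr0n; lia.
have cardTC : (#|T| + #|~: T| = n)%N by rewrite cardsC card_ord.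
have [T0 TC0 le_n le_TC] := half_split n5 cardT cardTC.
have WTC : (within e (~: T))%:R <= zeta * d%:R * n%:R :> R.
  have /(congr1 (fun k => k%:R : R)) := covered_within e_simple e_reg T.
  have /(congr1 (fun k => k%:R : R)) := card_edges e_simple e_reg.
  rewrite natrD !natrM => hE hcov; move: covT.
  have -> : #|edges e|%:R = d%:R * n%:R / 2 :> R by lra.
  lra.
(* By balance, the smaller side contains no more pairs than the larger one, so the covering side is
   sparse too. *)
have WT : (within e T <= within e (~: T))%N.
  have := within_balance e_simple e_reg T.
  have := leq_mul (leqnn d) le_TC; clear; lia.
have WT' : (within e T)%:R <= zeta * d%:R * n%:R :> R.
  by apply: le_trans WTC; rewrite ler_nat.
have hn : n%:R <= 5 / 2 * #|T|%:R :> R.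
  by move: le_n; rewrite -(ler_nat R) !natrM; lra.
have zd0 : 0 < zeta * d%:R by rewrite mulr_gt0.
have dens B : #|T|%:R <= #|B|%:R :> R -> (within e B)%:R <= zeta * d%:R * n%:R :> R ->
    density B <= 5 / 2 * zeta * d%:R.
  move=> hB hW; have B0 : 0 < #|B|%:R :> R.
    by apply: lt_le_trans hB; rewrite ltr0n.
  rewrite ler_pdivrMr // (le_trans hW) //.
  have := ler_wpM2l (ltW zd0) (le_trans hn (ler_wpM2l _ hB)); lra.
have densT := dens T (lexx _) WT'.
have densTC : density (~: T) <= 5 / 2 * zeta * d%:R.
  by apply: dens WTC; rewrite ler_nat.
have [C optC] := optimal_centers_gain optS.
have sum_ge : 2 * lam ^+ 2 - 10 * zeta * d%:R * lam <= gain X T + gain X (~: T).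
  have [g1 _] := andP (gain_graph_points T0).
  have [g2 _] := andP (gain_graph_points TC0).
  have := ler_wpM2l (ltW lam0) densT; have := ler_wpM2l (ltW lam0) densTC; lra.
have optT := optC T (centroid_graph_points_neq T0).
have sq0 B : 0 <= #|B|%:R * sqdist (row 0 S) (centroid X B).
  by rewrite mulr_ge0 // sqdist_ge0.
have empty_gain B : #|B| = 0%N -> gain X B = 0.
  by move=> B0; rewrite /gain B0 invr0 mulr0.
(* A single cluster gains at most [lam ^+ 2 + d%:R ^+ 2], far below the nearly [2 * lam ^+ 2] of
   [T], because [10 * d%:R <= lam]. *)
have not_one B : #|B| = 0%N -> gain X C + gain X (~: C) = gain X (~: B) -> False.
  move=> _ E; have := gain_graph_points_leq (~: B); have := sq0 C.
  have h1 : zeta * d%:R * lam <= 1 / 10 * d%:R * lam.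
    by rewrite !ler_wpM2r ?ltW.
  have h2 : d%:R * d%:R <= d%:R * lam by rewrite ler_wpM2l ?ltW.
  have h3 : 10 * d%:R * lam <= lam * lam.
    rewrite ler_wpM2r ?(ltW lam0) //.
    have : zeta * lam <= 1 / 10 * lam by rewrite ler_wpM2r ?ltW.
    lra.
  have h4 : 0 < d%:R * lam by rewrite mulr_gt0.
  move: optT; rewrite E; rewrite !expr2 in sum_ge *; lra.
have C0 : (0 < #|C|)%N.
  rewrite lt0n; apply/eqP => C0; apply: (not_one C C0).
  by rewrite (empty_gain C C0) add0r.
have CC0 : (0 < #|~: C|)%N.
  rewrite lt0n; apply/eqP => C1; apply: (not_one (~: C) C1).
  by rewrite (empty_gain (~: C) C1) addr0 finset.setCK.
exists C; split.
  (* With [B := C] the gains cancel, so the first center is exactly the centroid of [C] and its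
     signs give membership. *)
  have := optC C (centroid_graph_points_neq C0).
  rewrite gerDl => h u; have : #|C|%:R * sqdist (row 0 S) (centroid X C) = 0.
    by apply/eqP; rewrite eq_le h sq0.
  move=> /eqP; rewrite mulf_eq0 pnatr_eq0 (gtn_eqF C0) /= => /eqP /sqdist_eq0.
  by move=> /rowP /(_ u); rewrite -centroid_graph_points_gt0 mxE => ->.
have [_ g1] := andP (gain_graph_points C0).
have [_ g2] := andP (gain_graph_points CC0).
have := within_density C; have := within_density (~: C).
(* The deficit [10 * zeta * d * lam] and the two errors [d ^ 2 <= zeta * d * lam] make 12, and
   division by [2 * lam] leaves 6. *)
have key : density C + density (~: C) <= 6 * zeta * d%:R.
  have h : d%:R * d%:R <= d%:R * (zeta * lam) by rewrite ler_wpM2l.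
  rewrite -(ler_pM2l lam0); move: (sq0 C) sum_ge g1 g2 optT; rewrite !expr2; lra.
have := ler_wpM2l (ltW n0) key; lra.
Qed.

End GraphPoints.

(** * Encodings *)

Lemma nth_flatten_const (T : Type) (x0 : T) (k : nat) (ss : seq (seq T)) i j :
  (forall m, (m < size ss)%N -> size (nth [::] ss m) = k) ->
  (i < size ss)%N -> (j < k)%N ->
  nth x0 (flatten ss) (i * k + j) = nth x0 (nth [::] ss i) j.
Proof.
elim: ss i => //= s ss IH i hk hi hj; rewrite nth_cat (hk 0%N) //.
case: i hi => [_|i hi]; first by rewrite mul0n add0n hj.
rewrite mulSn -addnA ltnNge leq_addr /= addKn.
by apply: IH => // m; exact: (hk m.+1).
Qed.

Lemma nth_allpairs_ord (T : Type) (x0 : T) m D (f : 'I_m -> 'I_D -> T)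
    (i : 'I_m) (j : 'I_D) :
  nth x0 [seq f u v | u <- enum 'I_m, v <- enum 'I_D] (i * D + j) = f i j.
Proof.
have szm : size [seq [seq f u v | v <- enum 'I_D] | u <- enum 'I_m] = m.
  by rewrite size_map size_enum_ord.
rewrite nth_flatten_const ?szm //.
  rewrite (nth_map i) ?size_enum_ord // (nth_map j) ?size_enum_ord //.
  by rewrite !nth_ord_enum.
move=> k hk; rewrite (nth_map i) ?size_enum_ord //.
by rewrite size_map size_enum_ord.
Qed.

Lemma size_allpairs_ord (T : Type) m D (f : 'I_m -> 'I_D -> T) :
  size [seq f u v | u <- enum 'I_m, v <- enum 'I_D] = (m * D)%N.
Proof. by rewrite size_allpairs !size_enum_ord. Qed.

Lemma nth_encode_points m D (M : 'M[rat]_(m, D)) (i : 'I_m) (j : 'I_D) b : (b < 2)%N ->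
  nth 0 (encode_points M) (2 * (i * D + j) + b) =
  if b == 0%N then numq (M i j) else denq (M i j).
Proof.
move=> b2; rewrite /encode_points mulnC nth_flatten_const //.
- rewrite (nth_allpairs_ord [::] (fun i j => [:: numq (M i j); denq (M i j)])).
  by case: b b2 => [|[|]].
- move=> k; rewrite size_allpairs_ord => hk.
  have D0 : (0 < D)%N by case: D M j hk => // M [].
  have hi : (k %/ D < m)%N by rewrite ltn_divLR.
  have hj : (k %% D < D)%N by rewrite ltn_mod.
  have := nth_allpairs_ord [::] (fun i j => [:: numq (M i j); denq (M i j)])
    (Ordinal hi) (Ordinal hj).
  by rewrite /= -divn_eq => ->.
- rewrite size_allpairs_ord (@leq_trans (i.+1 * D)) ?leq_mul2r ?ltn_ord ?orbT //.
  by rewrite mulSn addnC ltn_add2r.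
Qed.

Lemma size_encode_points m D (M : 'M[rat]_(m, D)) :
  size (encode_points M) = (2 * (m * D))%N.
Proof.
rewrite /encode_points size_flatten sumnE /shape big_map big_seq.
rewrite (eq_bigr (fun=> 2%N)) => [|_ /allpairsP[p [_ _ ->]] //].
by rewrite -big_seq big_const_seq count_predT iter_addn_0 size_allpairs_ord.
Qed.

Lemma mem_encode_points m D (M : 'M[rat]_(m, D)) x : x \in encode_points M ->
  exists i j, x = numq (M i j) \/ x = denq (M i j).
Proof.
move=> /flattenP[_ /allpairsP[[i j] [_ _ ->]]]; rewrite !inE => /orP[] /eqP ->; exists i, j;
  by [left | right].
Qed.

Lemma load_nat l (k : nat) :
  load l k.+1%:Z = nth 0 l k.
Proof. by []. Qed.

Lemma load_neg l (a : int) : a < 0 -> load l a = 0.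
Proof. by case: a. Qed.

Lemma cells_le_load l B : (bitlen (size l)%:Z <= B)%N ->
  (forall x, x \in l -> (bitlen x <= B)%N) -> cells_le B (load l).
Proof.
move=> hs hl [[|k]|k]; rewrite /load //=; last exact: leq_trans hs.
case: (ltnP k (size l)) => hk; first exact/hl/mem_nth.
by rewrite nth_default //; exact: leq_trans hs.
Qed.

(** The offset 2 skips the length of the word and the number of vertices. *)
Lemma load_encode_graph n (e : rel 'I_n) (u v : 'I_n) :
  load (encode_graph e) (u * n + v).+2%:Z = (e u v : nat)%:Z.
Proof. exact: (nth_allpairs_ord 0 (fun u v => (e u v : nat)%:Z)). Qed.

Definition graph_kmeans n (e : rel 'I_n) : seq int :=
  encode_kmeans (graph_points (n ^ 2)%:R e) 2.

Lemma graph_points_int n (e : rel 'I_n) u v :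
  graph_points (n ^ 2)%:R e u v = ((n ^ 2 * (u == v))%:Z - (e u v : nat)%:Z)%:~R :> rat.
Proof.
by rewrite mxE rmorphB /= -!pmulrn; case: (u == v); rewrite ?muln1 ?muln0.
Qed.

Lemma load_graph_kmeans n (e : rel 'I_n) (i : nat) : (i < n * n)%N ->
  load (graph_kmeans e) (4 + 2 * i)%N%:Z =
    (n ^ 2 * (n.+1 %| i))%N%:Z - load (encode_graph e) i.+2%:Z /\
  load (graph_kmeans e) (5 + 2 * i)%N%:Z = 1.
Proof.
move=> hi.
have n0 : (0 < n)%N by case: n hi e.
have hu : (i %/ n < n)%N by rewrite ltn_divLR.
have hv : (i %% n < n)%N by rewrite ltn_mod.
pose u := Ordinal hu; pose v := Ordinal hv.
have Ei : i = (u * n + v)%N by exact: divn_eq.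
(* A multiple [k * n.+1] below [n * n] has [k < n], so its quotient and remainder by [n] are both
   [k]. *)
have Ediag : (n.+1 %| i)%N = (u == v).
  apply/idP/eqP => [/dvdnP[k Ek]|Euv].
    have hk : (k < n)%N.
      by rewrite ltnNge; apply/negP => nk; move: hi; rewrite Ek; nia.
    apply: val_inj => /=; rewrite Ek mulnSr.
    by rewrite divnMDl // modnMDl divn_small // modn_small // addn0.
  by apply/dvdnP; exists u; rewrite Ei -Euv mulnSr.
have := load_encode_graph e u v; rewrite -Ei => ->.
rewrite Ediag /graph_kmeans /encode_kmeans.
have h b : (b < 2)%N -> load ([:: n%:Z; 2%:Z; n%:Z] ++
    encode_points (graph_points (n ^ 2)%:R e)) (4 + 2 * i + b)%N%:Z =
    nth 0 (encode_points (graph_points (n ^ 2)%:R e)) (2 * (u * n + v) + b).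
  by rewrite -Ei.
have := h 0%N isT; have := h 1%N isT.
rewrite !nth_encode_points // graph_points_int /= numq_int denq_int addn0.
by move=> <- <-; split=> //; congr load; lia.
Qed.

Lemma load_graph_kmeans_head n (e : rel 'I_n) :
  [/\ load (graph_kmeans e) 0 = (3 + 2 * (n * n))%N%:Z, load (graph_kmeans e) 1 = n%:Z,
      load (graph_kmeans e) 2 = 2 & load (graph_kmeans e) 3 = n%:Z].
Proof.
split=> //; rewrite /load /= size_encode_points; congr Posz; lia.
Qed.

Lemma load_graph_kmeans_out n (e : rel 'I_n) a :
  a < 0 \/ (4 + 2 * (n * n))%N%:Z <= a -> load (graph_kmeans e) a = 0.
Proof.
case=> [|ha]; first exact: load_neg.
case: a ha => [[|k]|//] ha; first lia.
by rewrite load_nat nth_default // /= size_encode_points; lia.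
Qed.

Lemma mem_graph_kmeans n (e : rel 'I_n) x : (2 <= n)%N ->
  x \in graph_kmeans e -> (`|x| <= n ^ 2)%N.
Proof.
move=> n2; have nn : (n <= n ^ 2)%N by rewrite -mulnn leq_pmulr //; lia.
rewrite !inE => /or4P[/eqP->|/eqP->|/eqP->|] //=; try by (simpl; lia).
move=> /mem_encode_points[u [v]]; rewrite graph_points_int numq_int denq_int.
case=> ->; last by lia.
case: (u == v); case: (e u v); rewrite ?muln1 ?muln0; lia.
Qed.

Lemma input_size_leq l b : (forall x, x \in l -> (bitlen x <= b)%N) ->
  (input_size l <= size l * b)%N.
Proof.
move=> h; rewrite /input_size big_seq.
rewrite -sum1_size big_distrl /= [X in (_ <= X)%N]big_seq.
by apply: leq_sum => x /h; rewrite mul1n.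
Qed.

(** Deliberately crude: each of the [2 * (n * n) + 3] entries is charged [n ^ 2 + 1] bits, which is
    still polynomial. *)
Lemma input_size_graph_kmeans n (e : rel 'I_n) : (2 <= n)%N ->
  (input_size (graph_kmeans e) <= 6 * n ^ 4)%N.
Proof.
move=> n2; apply: leq_trans (input_size_leq (b := (n ^ 2).+1) _) _.
  move=> x /(mem_graph_kmeans n2) hx; apply: leq_trans (bitlen_leq_abs x) _.
  by rewrite ltnS.
rewrite /= size_encode_points (expnM n 2 2) -[in X in (_ <= X)%N]mulnn mulnn.
have : (4 <= n ^ 2)%N by rewrite -mulnn; nia.
set m := (n ^ 2)%N; nia.
Qed.

Lemma cells_le_graph_kmeans n (e : rel 'I_n) : (2 <= n)%N ->
  cells_le (2 * n ^ 2 + 5) (load (graph_kmeans e)).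
Proof.
move=> n2; apply: cells_le_load.
  apply: leq_trans (bitlen_leq_abs _) _ => /=.
  rewrite size_encode_points -mulnn; lia.
move=> x /(mem_graph_kmeans n2) hx; apply: leq_trans (bitlen_leq_abs x) _; lia.
Qed.

Lemma cells_le_encode_graph n (e : rel 'I_n) : (2 <= n)%N ->
  cells_le (2 * n ^ 2 + 5) (load (encode_graph e)).
Proof.
move=> n2; apply: cells_le_load.
  apply: leq_trans (bitlen_leq_abs _) _ => /=.
  rewrite size_allpairs_ord -mulnn; lia.
have nn : (n <= n ^ 2)%N by rewrite -mulnn leq_pmulr //; lia.
move=> x; rewrite inE => /orP[/eqP ->|/allpairsP[p [_ _ ->]]].
  by apply: leq_trans (bitlen_leq_abs _) _ => /=; lia.
by rewrite bitlen_bool; lia.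
Qed.

(** * The reduction program *)

Definition assign_rate (a e : expr) : nat := (expr_rate a + expr_rate e).+1.

Lemma runs_assign_val B a e s x v : (0 < B)%N -> cells_le B s ->
  expr_val a s = x -> expr_val e s = v ->
  runs (CAssign a e) s (assign_rate a e * B) (upd s x v).
Proof. by move=> B0 h <- <-; exact: runs_assign. Qed.

Lemma upd_reloc s a v a' :
  upd s (reloc_addr a) v (reloc_addr a') = if a' == a then v else s (reloc_addr a').
Proof. by rewrite /upd (inj_eq reloc_addr_inj). Qed.

Lemma upd_reloc_other s a v b : - 3 < b -> upd s (reloc_addr a) v b = s b.
Proof. exact: same_outside_upd. Qed.

Lemma upd_other_reloc s b v a : - 3 < b -> upd s b v (reloc_addr a) = s (reloc_addr a).
Proof. by move=> hb; rewrite /upd; case: eqP => // E; have := reloc_addr_le a; lia. Qed.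

Lemma upd_nat s b v (k : nat) : b < 0 -> upd s b v k%:Z = s k%:Z.
Proof. by move=> hb; rewrite /upd; case: eqP => // E; lia. Qed.

Lemma upd_neq s a v b : b != a -> upd s a v b = s b.
Proof. by rewrite /upd => /negbTE ->. Qed.

Lemma upd_same s b v : upd s b v b = v.
Proof. by rewrite /upd eqxx. Qed.

(* The input graph stays in the nonnegative cells, the relocated k-means solver
   works below cell -2, and cells -1 and -2 are a counter and a running sum. *)
Definition vN := EMem (ECst 1).
Definition vI := EMem (ECst (- 1)).
Definition vSum := EMem (ECst (- 2)).
Definition vNN := EMul vN vN.

Definition more := ELeq (EAdd vI (ECst 1)) vNN.
Definition next := CAssign (ECst (- 1)) (EAdd vI (ECst 1)).
Definition next_rate := assign_rate (ECst (- 1)) (EAdd vI (ECst 1)).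

Lemma expr_val_more s (n i : nat) : s 1 = n%:Z -> s (- 1) = i%:Z ->
  expr_val more s = ((i < n * n)%N : nat)%:Z.
Proof. by move=> /= -> ->; congr Posz; congr nat_of_bool; lia. Qed.

(* A flat index [i = u * n + v] below [n * n] is on the diagonal iff [n + 1]
   divides [i]. *)
Definition isdiag :=
  ELeq (ESub vI (EMul (EAdd vN (ECst 1)) (EDiv vI (EAdd vN (ECst 1))))) (ECst 0).
Definition entry := ESub (EMul vNN isdiag) (EMem (EAdd (ECst 2) vI)).

Lemma expr_val_isdiag s (n i : nat) : s 1 = n%:Z -> s (- 1) = i%:Z ->
  expr_val isdiag s = ((n.+1 %| i)%N : nat)%:Z.
Proof.
move=> /= -> ->; have -> : n%:Z + 1 = n.+1%:Z by lia.
rewrite divz_nat; congr Posz; congr nat_of_bool.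
have := divn_eq i n.+1; rewrite /dvdn; lia.
Qed.

Definition num_addr := EReloc (EAdd (ECst 4) (EMul (ECst 2) vI)).
Definition den_addr := EReloc (EAdd (ECst 5) (EMul (ECst 2) vI)).

Definition write_point :=
  CSeq (CAssign num_addr entry) (CSeq (CAssign den_addr (ECst 1)) next).

(** After the points come the length of the word and its header, with 2 as the number of centers.
    The counter is finally reset for the loop that runs after the solver. *)
Definition write_kmeans :=
  CSeq (CWhile more write_point)
  (CSeq (CAssign (EReloc (ECst 0)) (EAdd (ECst 3) (EMul (ECst 2) vNN)))
  (CSeq (CAssign (EReloc (ECst 1)) vN)
  (CSeq (CAssign (EReloc (ECst 2)) (ECst 2))
  (CSeq (CAssign (EReloc (ECst 3)) vN)
        (CAssign (ECst (- 1)) (ECst 0)))))).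

(** The relocated word is filled from cell 4 on; its cells 0 to 3 remain 0 throughout the loop. *)
Definition write_inv n (e : rel 'I_n) (i : nat) (s : store) : Prop :=
  [/\ s (- 1) = i%:Z, s (- 2) = 0, forall k : nat, s k%:Z = load (encode_graph e) k%:Z,
      forall a, s (reloc_addr a) =
        if (4 <= a) && (a < (4 + 2 * i)%N%:Z) then load (graph_kmeans e) a else 0
    & cells_le (2 * n ^ 2 + 5) s].

Lemma write_inv0 n (e : rel 'I_n) : (2 <= n)%N -> write_inv e 0 (load (encode_graph e)).
Proof.
move=> n2; split=> // [a|]; last exact: cells_le_encode_graph.
have := reloc_addr_le a; rewrite load_neg; last by have := reloc_addr_le a; lia.
by case: ifP => //; lia.
Qed.

Lemma bitlen_nat_leq (k B : nat) : (k < B)%N -> (bitlen k%:Z <= B)%N.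
Proof. by move=> kB; apply: leq_trans (bitlen_leq_abs k) _. Qed.

(** [K] is chosen before the graph: the code is fixed, so its cost is linear in the bit bound on the
    cells. *)
Lemma write_point_step : exists K, forall n (e : rel 'I_n) i s, (2 <= n)%N ->
  (i < n * n)%N -> write_inv e i s ->
  exists2 s', runs write_point s (K * (2 * n ^ 2 + 5)) s' & write_inv e i.+1 s'.
Proof.
exists (assign_rate num_addr entry + assign_rate den_addr (ECst 1) + next_rate + 2)%N.
move=> n e i s n2 hi [hI hSum hin hrel hB]; set B := (2 * n ^ 2 + 5)%N in hB *.
have B0 : (0 < B)%N by rewrite /B addnS.
have [e4 e5] := load_graph_kmeans e hi.
have s1 : s 1 = n%:Z by exact: (hin 1%N).
pose a4 := (4 + 2 * i)%N%:Z; pose a5 := (5 + 2 * i)%N%:Z.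
pose v4 := load (graph_kmeans e) a4.
pose s' := upd s (reloc_addr a4) v4.
pose s'' := upd s' (reloc_addr a5) 1.
have hB' : cells_le B s' by apply: cells_le_upd => //; exact: cells_le_graph_kmeans.
have hB'' : cells_le B s''.
  by apply: cells_le_upd => //; rewrite (bitlen_bool true).
have r1 : runs (CAssign num_addr entry) s (assign_rate num_addr entry * B) s'.
  apply: (runs_assign_val B0 hB).
    by rewrite expr_val_EReloc /= hI; congr reloc_addr; rewrite /a4; lia.
  rewrite /v4 e4 /entry; have := expr_val_isdiag s1 hI; move: isdiag => x /= ->.
  rewrite s1 hI; have -> : 2 + i%:Z = i.+2%:Z by lia.
  by rewrite hin; congr (_ - _); rewrite -mulnn; lia.
have r2 : runs (CAssign den_addr (ECst 1)) s' (assign_rate den_addr (ECst 1) * B) s''.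
  apply: (runs_assign_val B0 hB') => //.
  by rewrite expr_val_EReloc /= /s' upd_reloc_other // hI; congr reloc_addr; rewrite /a5; lia.
have r3 : runs next s'' (next_rate * B) (upd s'' (- 1) i.+1%:Z).
  apply: (runs_assign_val B0 hB'') => //=.
  by rewrite /s'' /s' !upd_reloc_other // hI; lia.
exists (upd s'' (- 1) i.+1%:Z).
  apply: runs_leq (runs_seq r1 (runs_seq r2 r3)).
  by rewrite !mulnDl; lia.
split.
- by rewrite upd_same.
- by rewrite upd_neq // /s'' /s' !upd_reloc_other.
- by move=> k; rewrite upd_nat // /s'' /s' !upd_reloc_other //; lia.
- move=> a; rewrite upd_other_reloc // /s'' /s' !upd_reloc.
  case: eqP => [->|n5]; first by rewrite e5 /a5; case: ifP => //; lia.
  case: eqP => [->|n4]; first by rewrite /a4; case: ifP => //; lia.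
  rewrite hrel; congr (if _ then _ else _); rewrite /a5 /a4 in n5 n4; lia.
- apply: cells_le_upd => //; apply: bitlen_nat_leq; rewrite /B; move: hi; rewrite -mulnn; lia.
Qed.

Lemma runs_write_kmeans : exists K, forall n (e : rel 'I_n), (2 <= n)%N ->
  exists2 s, runs write_kmeans (load (encode_graph e)) (K * n ^ 4) s &
  [/\ s (- 1) = 0, s (- 2) = 0,
      forall k : nat, s k%:Z = load (encode_graph e) k%:Z,
      simulates (load (graph_kmeans e)) s & cells_le (2 * n ^ 2 + 5) s].
Proof.
have [K hK] := write_point_step.
pose vSize := EAdd (ECst 3) (EMul (ECst 2) vNN).
pose rates := (assign_rate (EReloc (ECst 0)) vSize + assign_rate (EReloc (ECst 1)) vN +
  assign_rate (EReloc (ECst 2)) (ECst 2) + assign_rate (EReloc (ECst 3)) vN +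
  assign_rate (ECst (- 1)) (ECst 0))%N.
exists (8 * (expr_rate more + K + 1) + 4 * rates + 5)%N => n e n2.
set B := (2 * n ^ 2 + 5)%N in hK *; have B0 : (0 < B)%N by rewrite /B addnS.
have := @runs_while more write_point (write_inv e) (n * n) (expr_rate more * B)
  (K * B) _ _ _ (write_inv0 e n2).
case=> [i s hi inv|s inv|s0 r0 [hI hSum hin hrel hB]].
- have [hI _ hin _ hB] := inv; split.
  + by rewrite (@expr_val_more s n i) ?(hin 1%N) // hi.
  + exact: expr_cost_leq.
  + exact: hK.
- have [hI _ hin _ hB] := inv; split; last exact: expr_cost_leq.
  by rewrite (@expr_val_more s n (n * n)) ?(hin 1%N) // ltnn.
have [l0 l1 l2 l3] := load_graph_kmeans_head e.
have cA := cells_le_graph_kmeans e n2; rewrite -/B in cA.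
pose s1 := upd s0 (reloc_addr 0) (load (graph_kmeans e) 0).
pose s2 := upd s1 (reloc_addr 1) (load (graph_kmeans e) 1).
pose s3 := upd s2 (reloc_addr 2) (load (graph_kmeans e) 2).
pose s4 := upd s3 (reloc_addr 3) (load (graph_kmeans e) 3).
have c1 : cells_le B s1 by exact: cells_le_upd.
have c2 : cells_le B s2 by exact: cells_le_upd.
have c3 : cells_le B s3 by exact: cells_le_upd.
have c4 : cells_le B s4 by exact: cells_le_upd.
have hn : s0 1 = n%:Z by exact: (hin 1%N).
have r1 : runs (CAssign (EReloc (ECst 0)) vSize) s0
    (assign_rate (EReloc (ECst 0)) vSize * B) s1.
  by apply: runs_assign_val => //=; rewrite hn l0; lia.
have r2 : runs (CAssign (EReloc (ECst 1)) vN) s1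
    (assign_rate (EReloc (ECst 1)) vN * B) s2.
  by apply: runs_assign_val => //=; rewrite /s1 upd_reloc_other // hn l1.
have r3 : runs (CAssign (EReloc (ECst 2)) (ECst 2)) s2
    (assign_rate (EReloc (ECst 2)) (ECst 2) * B) s3.
  exact: runs_assign_val.
have r4 : runs (CAssign (EReloc (ECst 3)) vN) s3
    (assign_rate (EReloc (ECst 3)) vN * B) s4.
  by apply: runs_assign_val => //=; rewrite /s3 /s2 /s1 !upd_reloc_other // hn l3.
have r5 : runs (CAssign (ECst (- 1)) (ECst 0)) s4
    (assign_rate (ECst (- 1)) (ECst 0) * B) (upd s4 (- 1) 0).
  exact: runs_assign_val.
exists (upd s4 (- 1) 0).
  apply: runs_leq (runs_seq r0 (runs_seq r1 (runs_seq r2 (runs_seq r3 (runs_seq r4 r5))))).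
  rewrite (expnM n 2 2) -!mulnn.
  have m4 : (4 <= n * n)%N by nia.
  have BE : B = (2 * (n * n) + 5)%N by rewrite /B -mulnn.
  set m := (n * n)%N in m4 BE *.
  set a := expr_rate more; rewrite /rates.
  set x1 := assign_rate _ _; set x2 := assign_rate _ _; set x3 := assign_rate _ _.
  set x4 := assign_rate _ _; set x5 := assign_rate _ _.
  have Bm : (B <= 4 * m)%N by lia.
  have t1 : (m.+1 * (a * B + K * B).+1 <= 8 * (a + K + 1) * (m * m))%N.
    apply: (@leq_trans (2 * m * ((a + K + 1) * (4 * m)))); last by lia.
    apply: leq_mul; first lia.
    apply: (@leq_trans ((a + K + 1) * B)); first lia.
    by rewrite leq_mul2l Bm orbT.
  have t2 : ((x1 + x2 + x3 + x4 + x5) * B <= 4 * (x1 + x2 + x3 + x4 + x5) * (m * m))%N.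
    apply: (@leq_trans ((x1 + x2 + x3 + x4 + x5) * (4 * m))).
      by rewrite leq_mul2l Bm orbT.
    by rewrite mulnA [X in (X * m)%N]mulnC leq_mul2l leq_pmulr ?orbT //; lia.
  move: t1 t2; lia.
split.
- by rewrite upd_same.
- by rewrite upd_neq // /s4 /s3 /s2 /s1 !upd_reloc_other.
- by move=> k; rewrite upd_nat // /s4 /s3 /s2 /s1 !upd_reloc_other //; lia.
- move=> a; rewrite upd_other_reloc // /s4 /s3 /s2 /s1 !upd_reloc.
  do 4![case: eqP => [-> //|?]].
  rewrite hrel; case: ifP => // ha; rewrite load_graph_kmeans_out //; lia.
- exact: cells_le_upd.
Qed.

(* The output of the solver has the numerator of coordinate [u] of the first
   center in cell [1 + 2 * u]. *)
Definition side (e : expr) :=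
  ELeq (ECst 1) (EMem (EReloc (EAdd (ECst 1) (EMul (ECst 2) e)))).
Definition vRow := EDiv vI vN.
Definition vCol := ESub vI (EMul vN vRow).
Definition vCross := ESub (side vRow) (side vCol).

(* [1 - vCross ^ 2] is 1 if both ends are on the same side and 0 otherwise. *)
Definition add_pair (q : nat) := EAdd vSum (EMul (EMem (EAdd (ECst 2) vI))
  (ESub (EMul (ECst q%:Z) (ESub (ECst 1) (EMul vCross vCross))) (ECst 1))).

(** Cell 1 holds [n] during the loop and is overwritten by the answer only afterwards; the final 1
    in cell 0 is the length of the output. *)
Definition sum_pairs (q : nat) :=
  CSeq (CWhile more (CSeq (CAssign (ECst (- 2)) (add_pair q)) next))
  (CSeq (CAssign (ECst 1) (ELeq vSum (ECst 0))) (CAssign (ECst 0) (ECst 1))).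

Definition sideval (s : store) (u : nat) : int := ((1 <= s (1 + 2 * u%:Z))%R : nat)%:Z.

(** An adjacent ordered pair contributes [q - 1] if both ends lie on the same side and [- 1]
    otherwise. The total is [q] times the number of pairs inside the sides, minus [d * n]. *)
Definition pair_term (q n : nat) (inp sA : store) (j : nat) : int :=
  inp j.+2%:Z * (q%:Z * (1 - (sideval sA (j %/ n) - sideval sA (j %% n)) ^+ 2) - 1).

Lemma pair_term_leq q n inp sA j :
  0 <= inp j.+2%:Z <= 1 -> (`|pair_term q n inp sA j| <= q.+1)%N.
Proof.
rewrite /pair_term /sideval => /andP[h0 h1].
have [-> | ->] : inp j.+2%:Z = 0 \/ inp j.+2%:Z = 1 by lia.
  by rewrite mul0r.
by rewrite mul1r; do 2!case: (1 <= _); rewrite ?expr2; lia.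
Qed.

Lemma expr_val_add_pair q s inp sA (n i : nat) (acc : int) :
  (0 < n)%N -> s (- 1) = i%:Z -> s (- 2) = acc -> s 1 = n%:Z ->
  s i.+2%:Z = inp i.+2%:Z -> simulates sA s ->
  expr_val (add_pair q) s = acc + pair_term q n inp sA i.
Proof.
move=> n0 hI hSum hN hin sim.
have hrow : expr_val vRow s = (i %/ n)%N%:Z by rewrite /= hI hN divz_nat.
have hcol : expr_val vCol s = (i %% n)%N%:Z.
  have -> : expr_val vCol s = i%:Z - n%:Z * expr_val vRow s by rewrite /= hI hN.
  by rewrite hrow; have := divn_eq i n; lia.
have hside (e : expr) (u : nat) : expr_val e s = u%:Z -> expr_val (side e) s = sideval sA u.
  move=> he; rewrite /side [LHS]/= he -/(reloc_addr _) sim; exact: erefl.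
have hcross : expr_val vCross s = sideval sA (i %/ n) - sideval sA (i %% n).
  by rewrite -(hside _ _ hrow) -(hside _ _ hcol).
rewrite /add_pair; move: vCross hcross => x hx.
rewrite /= hSum hI hx; have -> : 2 + i%:Z = i.+2%:Z by lia.
by rewrite hin /pair_term expr2.
Qed.

(** The lower bound on [B] leaves room for the running sum, of absolute value at most
    [n ^ 2 * q.+1], and for the counter. *)
Lemma runs_sum_pairs q : exists K, forall (n B : nat) s inp,
  (2 <= n)%N -> (n ^ 2 * q.+1 + n ^ 2 + 2 <= B)%N ->
  s (- 1) = 0 -> s (- 2) = 0 -> (forall k : nat, s k%:Z = inp k%:Z) ->
  inp 1 = n%:Z -> (forall j, (j < n * n)%N -> 0 <= inp j.+2%:Z <= 1) ->
  cells_le B s ->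
  exists2 s', runs (sum_pairs q) s (K * n ^ 2 * B) s' &
    outputs s' [:: ((\sum_(0 <= j < n * n)
      pair_term q n inp (fun a => s (reloc_addr a)) j <= 0)%R : nat)%:Z].
Proof.
pose ra := assign_rate (ECst (- 2)) (add_pair q).
pose rf := (assign_rate (ECst 1) (ELeq vSum (ECst 0)) + assign_rate (ECst 0) (ECst 1))%N.
exists (2 * (expr_rate more + ra + next_rate + 2) + rf + 2)%N.
move=> n B s inp n2 hqB hI hSum hin hn hbit hB.
have B0 : (0 < B)%N by lia.
pose sA : store := fun a => s (reloc_addr a).
pose acc i := \sum_(0 <= j < i) pair_term q n inp sA j.
have hacc i : (i <= n * n)%N -> (`|acc i| <= i * q.+1)%N.
  elim: i => [|i IH] hi; first by rewrite /acc big_geq.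
  rewrite /acc big_nat_recr //= -/(acc i).
  have := IH (ltnW hi); have := pair_term_leq q n sA (hbit i hi).
  rewrite mulSn; move: (acc i) (pair_term _ _ _ _ _) => x y; lia.
have accB i : (i <= n * n)%N -> (bitlen (acc i) <= B)%N.
  move=> hi; apply: leq_trans (bitlen_leq_abs _) _.
  have := hacc i hi; have := leq_mul hi (leqnn q.+1); rewrite mulnn; lia.
pose I i (s' : store) := [/\ s' (- 1) = i%:Z, s' (- 2) = acc i,
  forall k : nat, s' k%:Z = inp k%:Z, simulates sA s' & cells_le B s'].
have I0 : I 0%N s by split=> //; rewrite hSum /acc big_geq.
have := @runs_while more (CSeq (CAssign (ECst (- 2)) (add_pair q)) next) I (n * n)
  (expr_rate more * B) ((ra + next_rate + 1) * B) s _ _ I0.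
case=> [i s1 hi [hI1 hSum1 hin1 sim1 hB1]|s1 [hI1 hSum1 hin1 sim1 hB1]|].
- split; first by rewrite (@expr_val_more s1 n i) ?(hin1 1%N) // hi.
    exact: expr_cost_leq.
  pose s2 := upd s1 (- 2) (acc i.+1).
  have r1 : runs (CAssign (ECst (- 2)) (add_pair q)) s1 (ra * B) s2.
    apply: runs_assign_val => //.
    rewrite (@expr_val_add_pair q s1 inp sA n i (acc i)) ?hin1 ?(hin1 1%N) //; last lia.
    by rewrite /acc big_nat_recr.
  have c2 : cells_le B s2 by apply: cells_le_upd => //; exact: accB.
  have r2 : runs next s2 (next_rate * B) (upd s2 (- 1) i.+1%:Z).
    by apply: runs_assign_val => //=; rewrite /s2 upd_neq // hI1; lia.
  exists (upd s2 (- 1) i.+1%:Z); first by apply: runs_leq (runs_seq r1 r2); lia.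
  split.
  + by rewrite upd_same.
  + by rewrite upd_neq // /s2 upd_same.
  + by move=> k; rewrite upd_nat // /s2 upd_nat.
  + by move=> a; rewrite upd_other_reloc // /s2 upd_other_reloc.
  + apply: cells_le_upd => //; apply: bitlen_nat_leq; move: hi hqB; rewrite mulnn; lia.
- split; last exact: expr_cost_leq.
  by rewrite (@expr_val_more s1 n (n * n)) ?(hin1 1%N) // ltnn.
move=> s1 r0 [hI1 hSum1 hin1 sim1 hB1].
set b : int := ((_ <= 0)%R : nat)%:Z.
pose s2 := upd s1 1 b; pose s3 := upd s2 0 1.
have r1 : runs (CAssign (ECst 1) (ELeq vSum (ECst 0))) s1
    (assign_rate (ECst 1) (ELeq vSum (ECst 0)) * B) s2.
  by apply: runs_assign_val => //=; rewrite hSum1.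
have c2 : cells_le B s2 by apply: cells_le_upd => //; rewrite bitlen_bool.
have r2 : runs (CAssign (ECst 0) (ECst 1)) s2 (assign_rate (ECst 0) (ECst 1) * B) s3.
  exact: runs_assign_val.
exists s3.
  apply: runs_leq (runs_seq r0 (runs_seq r1 r2)).
  rewrite -mulnn /rf; have m4 : (4 <= n * n)%N by nia.
  set m := (n * n)%N in m4 *.
  set x1 := assign_rate _ _; set x2 := assign_rate _ _; set a := expr_rate more.
  have t1 : (m.+1 * (a * B + (ra + next_rate + 1) * B).+1 <=
      2 * (a + ra + next_rate + 2) * (m * B))%N.
    apply: (@leq_trans (2 * m * ((a + ra + next_rate + 2) * B))); last by lia.
    by apply: leq_mul; lia.
  have t2 : ((x1 + x2 + 2) * B <= (x1 + x2 + 2) * (m * B))%N.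
    by rewrite leq_mul2l leq_pmull ?orbT //; lia.
  move: t1 t2; lia.
split; first by rewrite /s3 upd_same.
by case=> // _; rewrite /s3 upd_neq // /s2 upd_same.
Qed.

(** Here [m] stands for [n ^ 2], [t] for the time of the solver and [r] for its slowdown under
    relocation. *)
Lemma reduction_time (m t t' r K1 K2 q : nat) : (4 <= m)%N -> (t' <= r * t)%N ->
 ((K1 * m ^ 2 + (t' + K2 * m * (2 * m + 5 + r * t + m * q.+1 + m + 2)).+1).+1
 <= (K1 + r + K2 * (q + r + 8) + 2) * m ^ 2 * t.+1)%N.
Proof.
move=> hm ht.
have m1 : (1 <= m ^ 2)%N by rewrite expn_gt0; lia.
have mt : (m ^ 2 <= m ^ 2 * t.+1)%N by rewrite leq_pmulr.
have h1 : (K1 * m ^ 2 <= K1 * (m ^ 2 * t.+1))%N by rewrite leq_mul2l mt orbT.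
have h2 : (t' <= r * (m ^ 2 * t.+1))%N.
  apply: (leq_trans ht); rewrite leq_mul2l (@leq_trans t.+1) ?orbT //.
  by rewrite leq_pmull.
have h3 : (2 * m + 5 + r * t + m * q.+1 + m + 2 <= (q + r + 8) * (m * t.+1))%N.
  have : (t <= m * t.+1)%N by rewrite (@leq_trans t.+1) // leq_pmull; lia.
  move=> /(leq_mul (leqnn r)).
  have : (m <= m * t.+1)%N by rewrite leq_pmulr.
  move=> hm1; have := leq_mul (leqnn q) hm1; move: hm1; lia.
have := leq_mul (leqnn (K2 * m)) h3.
rewrite -!mulnn in h1 h2 m1 *; lia.
Qed.

(** * Cost and output of the complete reduction *)

Definition reduction (q : nat) (A : cmd) : cmd :=
  CSeq write_kmeans (CSeq (creloc A) (sum_pairs q)).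

Lemma runs_reduction q A : exists K, forall n (e : rel 'I_n) t sA w', (2 <= n)%N ->
  exec A (load (graph_kmeans e)) [::] t sA w' ->
  exists2 s', runs (reduction q A) (load (encode_graph e)) (K * n ^ 4 * t.+1) s' &
    outputs s' [:: ((\sum_(0 <= j < n * n)
      pair_term q n (load (encode_graph e)) sA j <= 0)%R : nat)%:Z].
Proof.
have [K1 h1] := runs_write_kmeans; have [K2 h2] := runs_sum_pairs q.
exists (K1 + creloc_rate A + K2 * (q + creloc_rate A + 8) + 2)%N.
move=> n e t sA w' n2 exA.
have [s1 r1 [hI1 hSum1 hin1 sim1 hB1]] := h1 n e n2.
have [t' [s2 [ex2 ht sim2 out2]]] := creloc_exec exA sim1.
(* The summand [creloc_rate A * t] covers whatever the relocated solver may have written in its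
   running time. *)
pose B := (2 * n ^ 2 + 5 + creloc_rate A * t + n ^ 2 * q.+1 + n ^ 2 + 2)%N.
have hB2 : cells_le B s2.
  by apply: cells_le_mono (exec_cells_le ex2 hB1); rewrite /B; lia.
have hin2 k : s2 k%:Z = load (encode_graph e) k%:Z by rewrite out2 //; lia.
have hbit j : (j < n * n)%N -> 0 <= load (encode_graph e) j.+2%:Z <= 1.
  move=> hj; have n0 : (0 < n)%N by lia.
  have hu : (j %/ n < n)%N by rewrite ltn_divLR.
  have hv : (j %% n < n)%N by rewrite ltn_mod.
  have := load_encode_graph e (Ordinal hu) (Ordinal hv).
  by rewrite /= -divn_eq => ->; case: (e _ _).
have sum2 : (n ^ 2 * q.+1 + n ^ 2 + 2 <= B)%N by rewrite /B; lia.
have out2' (b : int) : b = - 1 \/ b = - 2 -> s1 b = 0 -> s2 b = 0.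
  by move=> hb; rewrite out2 //; lia.
have [s3 r3] := h2 n B s2 (load (encode_graph e)) n2 sum2
  (out2' _ (or_introl erefl) hI1) (out2' _ (or_intror erefl) hSum1) hin2 erefl hbit hB2.
have -> : (fun a => s2 (reloc_addr a)) = sA by apply/funext => a; exact: sim2.
move=> o3; exists s3 => //; apply: runs_leq (runs_seq r1 (runs_seq (exec_nil_runs ex2) r3)).
rewrite (expnM n 2 2); apply: reduction_time ht.
by rewrite -mulnn; nia.
Qed.

Lemma big_square (V : zmodType) n (F : nat -> V) :
  \sum_(0 <= j < n * n) F j = \sum_(u < n) \sum_(v < n) F (u * n + v)%N.
Proof.
rewrite big_nat_mul big_mkord; apply: eq_bigr => u _.
by rewrite mulSn addnC -{1}(add0n (u * n)%N) big_addn addKn big_mkord;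
  apply: eq_bigr => v _; rewrite addnC.
Qed.

Definition positive_side n (sA : store) : {set 'I_n} :=
  [set u : 'I_n | 1 <= sA (1 + 2 * (u : nat)%:Z)].

Lemma same_side_within n (e : rel 'I_n) (C : {set 'I_n}) :
  (\sum_u \sum_v (e u v && ((u \in C) == (v \in C))) = within e C + within e (~: C))%N.
Proof.
rewrite /within (bigID (mem C)) /=; congr addn.
  apply: eq_bigr => u uC; rewrite [RHS]big_mkcond; apply: eq_bigr => v _.
  by rewrite uC; case: (v \in C); rewrite ?andbT ?andbF.
rewrite [LHS](eq_bigl (fun u => u \in ~: C)) => [|u]; last by rewrite inE.
apply: eq_bigr => u; rewrite inE => /negbTE uC.
rewrite [RHS]big_mkcond; apply: eq_bigr => v _.
by rewrite uC inE; case: (v \in C); rewrite ?andbT ?andbF.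
Qed.

Lemma sum_pair_term q n (e : rel 'I_n) d sA : (0 < n)%N -> regular_graph e d ->
  \sum_(0 <= j < n * n) pair_term q n (load (encode_graph e)) sA j =
  (q * (within e (positive_side n sA) + within e (~: positive_side n sA)))%N%:Z
  - (d * n)%N%:Z.
Proof.
move=> n0 e_reg; set C := positive_side n sA.
rewrite big_square.
have term (u v : 'I_n) : pair_term q n (load (encode_graph e)) sA (u * n + v) =
    q%:Z * (e u v && ((u \in C) == (v \in C)) : nat)%:Z - (e u v : nat)%:Z.
  rewrite /pair_term load_encode_graph divnMDl // modnMDl.
  rewrite divn_small // modn_small // addn0 /sideval !inE.
  by case: (e u v); case: (1 <= _); case: (1 <= _); rewrite /= ?expr2; lia.
under eq_bigr => u _ do under eq_bigr => v _ do rewrite term.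
under eq_bigr => u _ do rewrite sumrB -mulr_sumr.
rewrite sumrB -mulr_sumr; congr (_ - _).
  rewrite PoszM -same_side_within -(natz (\sum_u _)) natr_sum; congr (_ * _).
  apply: eq_bigr => u _; rewrite natr_sum; apply: eq_bigr => v _; exact: esym (natz _).
rewrite -(natz (d * n)) mulnC -[n in (n * d)%N]card_ord -sum_nat_const natr_sum.
apply: eq_bigr => u _; rewrite -(sum_neighbours e_reg u) natr_sum.
by apply: eq_bigr => v _; exact: esym (natz _).
Qed.

Lemma runs_halts_in c inp T s' : runs c (load inp) T s' -> halts_in c inp T.
Proof. by move=> r w; have [t [w' [tT ex]]] := r w; exists t, s', w'. Qed.

(** The output is the same for all tosses, so the probability 0.9 is met with certainty. *)
Lemma runs_prob_output (R : realType) c inp T s' out :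
  runs c (load inp) T s' -> outputs s' out -> prob_output R c inp T out = 1.
Proof.
move=> r hout; rewrite /prob_output; have -> : [set w : T.-tuple bool | `[< exists t s' w',
    [/\ exec c (load inp) w t s' w', (t <= T)%N & outputs s' out] >] ] = finset.setT.
  apply/finset.setP => w; rewrite !inE; apply/asboolP.
  by have [t [w' [tT ex]]] := r w; exists t, s', w'.
by rewrite cardsT card_tuple card_bool natrX divff.
Qed.

(** * Running times *)

Lemma ln_leq_powR (R : realType) (x b : R) : 0 < x -> 0 < b -> b * ln x <= x `^ b.
Proof.
move=> x0 b0; rewrite /powR gt_eqF //; have := expR_ge1Dx (b * ln x); lra.
Qed.

(** Compare exponents. With [y = x]^ (1 - b)[and]z = x [^ (b / 4)], every term on the left is at
    most a constant times [y * z], as [ln x <= 4 / b * z]; the right is [y * z * z * ln 2], and the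
    spare [z] absorbs the constants. *)
Lemma subexponential_growth (R : realType) (K E : nat) (b : R) : 0 < b < 1 ->
  exists n0 : nat, forall n : nat, (n0 <= n)%N ->
  K%:R * n%:R ^+ E * n%:R `^ ((2 * n%:R) `^ (1 - b)) <= 2 `^ (n%:R `^ (1 - b / 2)) :> R.
Proof.
move=> /andP[b0 b1].
have ln2 : 0 < ln 2 :> R by apply: ln_gt0; lra.
(* [K] comes from [K <= expR K], [E] from the power of [n], and 2 from the base [2 * n]. *)
pose M : R := (K + E + 2)%:R * (4 / b) / ln 2.
have b40 : 0 < b / 4 by rewrite divr_gt0.
have M0 : 0 < M by rewrite divr_gt0 // mulr_gt0 ?divr_gt0 // ltr0n addn2.
exists (Num.truncn (M `^ (4 / b))).+2 => n hn.
set x : R := n%:R.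
have x1 : 1 <= x by rewrite ler1n; apply: leq_trans hn.
have x0 : 0 < x by lra.
have lnx0 : 0 <= ln x by exact: ln_ge0.
have hM : M <= x `^ (b / 4).
  have Mx : M `^ (4 / b) <= x.
    apply: ltW; apply: lt_le_trans (_ : (Num.truncn (M `^ (4 / b))).+1%:R <= _).
      by rewrite truncnS_gt.
    by rewrite ler_nat ltnW.
  have -> : M = (M `^ (4 / b)) `^ (b / 4).
    rewrite -powRrM (_ : 4 / b * (b / 4) = 1) ?powRr1 ?ltW //.
    by field; rewrite gt_eqF.
  by apply: ge0_ler_powR; rewrite ?nnegrE ?powR_ge0 // ltW.
set y := x `^ (1 - b); set z := x `^ (b / 4).
have y1 : 1 <= y by rewrite -(powRr0 x); apply: ler_powR => //; lra.
have z1 : 1 <= z by rewrite -(powRr0 x); apply: ler_powR => //; exact: ltW.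
have hz : ln x <= 4 / b * z.
  have : 4 / b * (b / 4 * ln x) <= 4 / b * z.
    by rewrite ler_wpM2l ?(ln_leq_powR x0) // divr_ge0 // ltW.
  by rewrite mulrA (_ : 4 / b * (b / 4) = 1) ?mul1r //; field; rewrite gt_eqF.
have g2 : (2 * x) `^ (1 - b) <= 2 * y.
  rewrite powRM ?(ltW x0) // ler_wpM2r ?powR_ge0 //.
  by rewrite -[leRHS](@powRr1 _ 2) // ler_powR //; lra.
have hyz : x `^ (1 - b / 2) = y * z * z.
  have xn0 (r : R) : (r == 0) ==> (x != 0) by rewrite (gt_eqF x0) implybT.
  by rewrite /y /z -!powRD //; congr (_ `^ _); lra.
have -> : 2 `^ (x `^ (1 - b / 2)) = expR (y * z * z * ln 2).
  by rewrite hyz /powR gt_eqF.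
have hK : K%:R <= expR K%:R :> R by have := expR_ge1Dx (K%:R : R); lra.
have -> : x ^+ E = expR (E%:R * ln x) by rewrite expRM_natl lnK.
have -> : x `^ ((2 * x) `^ (1 - b)) = expR ((2 * x) `^ (1 - b) * ln x).
  by rewrite [LHS]/powR gt_eqF.
rewrite -mulrA -expRD.
apply: le_trans (ler_wpM2r (expR_ge0 _) hK) _.
rewrite -expRD ler_expR.
have e1 : (2 * x) `^ (1 - b) * ln x <= 2 * y * (4 / b * z).
  by apply: ler_pM => //; exact: powR_ge0.
have e2 : E%:R * ln x <= E%:R * (y * (4 / b * z)).
  rewrite ler_wpM2l // (le_trans hz) // ler_peMl //.
  by rewrite mulr_ge0 ?divr_ge0 ?(ltW b0) //; lra.
have b4 : 1 <= 4 / b by rewrite ler_pdivlMr //; lra.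
have e3 : K%:R <= K%:R * (y * (4 / b * z)) :> R.
  rewrite ler_peMr // -[leLHS]mul1r ler_pM // -[leLHS]mul1r ler_pM //.
have e4 : (K + E + 2)%:R * (4 / b) * (y * z) <= z * ln 2 * (y * z) :> R.
  rewrite ler_wpM2r ?mulr_ge0 //; [lra|lra|].
  by rewrite -ler_pdivrMr.
move: e4; rewrite !natrD; lra.
Qed.

(** * From a k-means solver to a distinguisher *)

Lemma map_graph_points (R : realType) (m : nat) n (e : rel 'I_n) :
  map_mx (ratr : rat -> R) (graph_points m%:R e) = graph_points m%:R e.
Proof.
by apply/matrixP => u v; rewrite !mxE rmorphB rmorphMn /= !ratr_nat.
Qed.

(** In column [u], row [u] has the positive entry [lam] and any other row an entry at most 0. *)
Lemma graph_points_distinct (F : numFieldType) (lam : F) n (e : rel 'I_n) :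
  irreflexive e -> 0 < lam -> distinct_rows (graph_points lam e).
Proof.
move=> irr lam0 u v /rowP/(_ u); rewrite !mxE eqxx irr subr0.
case: (eqVneq v u) => [-> //|_]; rewrite mulr0n sub0r => E.
by move: lam0; rewrite -[lam]mulr1n E oppr_gt0 le_gtF.
Qed.

Lemma optimal_positive_side (R : realType) n (S : 'M[rat]_(2, n)) sA :
  outputs sA (encode_points S) ->
  positive_side n sA = [set u | 0 < (map_mx (ratr : rat -> R) S) 0 u].
Proof.
case=> _ hout; apply/finset.setP => u; rewrite !inE mxE ltr0q -numq_gt0.
have hu : (2 * ((ord0 : 'I_2) * n + u) + 0 < size (encode_points S))%N.
  by rewrite size_encode_points; have := ltn_ord u; rewrite /=; lia.
have := hout _ hu; rewrite (@nth_encode_points _ _ S ord0 u 0) //= => <-.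
by congr (1 <= sA _); lia.
Qed.

Lemma kmeans_solver_distinguishes (R : realType) (delta zeta alpha b : R) (A : cmd)
    (T : nat -> nat -> nat -> R) :
  0 < delta <= 1 / 2 -> 0 < zeta -> zeta <= delta ^+ 5 / 10 -> 0 < b < 1 ->
  (forall n, (0 < n)%N -> T n 2 n <= n%:R `^ ((2 * n%:R) `^ (1 - b))) ->
  solves_kmeans_in_time A T ->
  exists A' : cmd, distinguishes delta zeta alpha (b / 2) A'.
Proof.
move=> /andP[delta0 delta_half] zeta0 hzeta hb hT [C hA].
have delta1 : delta < 1 by lra.
(* The program tests whether [q] times the number of pairs inside is at most [d * n]. Soundness
   needs [4 / delta <= q], completeness needs [6 * zeta * q <= 1]. *)
pose q := (Num.truncn (4 / delta)).+1.
have q_gt : 4 / delta < q%:R by exact: truncnS_gt.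
have q_lt : q%:R <= 4 / delta + 1.
  by rewrite /q -natr1 lerD2r truncn_le divr_ge0 // ltW.
have [K hK] := runs_reduction q A.
exists (reduction q A) => L c L1 c0.
(* The input size is at most [6 * n ^ 4]; its power [C] yields [6 ^ C] and the exponent [4 * C]. The
   [+ 1] accounts for [t.+1], the exponent 4 for the overhead of the reduction. *)
have [n0 hn0] := subexponential_growth (K * (C * 6 ^ C + 1)) (4 + 4 * C) hb.
have zeta_lt := truncnS_gt zeta^-1; have delta_lt := truncnS_gt (2 / delta).
move: (Num.truncn zeta^-1).+1 (Num.truncn (2 / delta)).+1 zeta_lt delta_lt.
move=> m1 m2 zeta_lt delta_lt; exists (n0 + 5 + m1 + m2)%N.
move=> n e hn [e_simple [d [k [e_reg hd _ _]]]].
have [n5 n0_n m1_n m2_n] : [/\ 5 <= n, n0 <= n, m1 <= n & m2 <= n]%N.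
  by split; move: hn; clear; lia.
have n2 : (2 <= n)%N by exact: leq_trans n5.
have n_gt0 : (0 < n)%N by exact: ltnW.
have n1 : 1 <= n%:R :> R by rewrite ler1n.
(* As [n >= 2], [log2 R n] is at least 1, so its power [L] is too, and [d] differs from that power
   by less than 1. *)
have d0 : (0 < d)%N.
  rewrite lt0n; apply/eqP => d0; move: hd; rewrite d0 sub0r normrN ltNge.
  case/negP; apply: le_trans (ler_norm _).
  have hlog : 1 <= log2 R n.
    rewrite /log2 ler_pdivlMr ?ln_gt0 ?ltr1n // mul1r ler_ln ?posrE ?ltr0n //.
    by rewrite ler_nat.
  by rewrite -(powRr0 (log2 R n)) ler_powR // (le_trans _ (ltW L1)).
have dn : (d <= n)%N.
  rewrite -(e_reg (Ordinal (leq_trans (isT : 0 < 2)%N n2))).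
  by rewrite -[X in (_ <= X)%N]card_ord max_card.
have zn : 1 <= zeta * n%:R.
  rewrite -ler_pdivrMl // mulr1; apply/ltW; apply: lt_le_trans zeta_lt _.
  by rewrite ler_nat.
have dltn : 2 / delta < n%:R.
  by apply: lt_le_trans delta_lt _; rewrite ler_nat.
pose P : 'M[rat]_n := graph_points (n ^ 2)%:R e.
have P_distinct : distinct_rows P.
  apply: graph_points_distinct (proj2 e_simple) _.
  by rewrite ltr0n expn_gt0 n_gt0.
have [t [sA [w' [S [exA tT outA optS]]]]] := hA n 2 n P n2 n_gt0 P_distinct.
have [s' r out] := hK n e t sA w' n2 exA.
rewrite (sum_pair_term _ _ n_gt0 e_reg) in out.
set Cp := positive_side n sA in out.
move=> T' inp.
have time : (K * n ^ 4 * t.+1 <= T')%N.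
  rewrite /T' -ltnS -(ltr_nat R); apply: le_lt_trans (truncnS_gt _).
  apply: le_trans (hn0 n n0_n).
  set G := n%:R `^ _.
  have G1 : 1 <= G.
    rewrite -[leLHS](powRr0 (n%:R : R)) ler_powR //; exact: powR_ge0.
  have t_le : t.+1%:R <= (C * 6 ^ C + 1)%:R * n%:R ^+ (4 * C) * G.
    have X1 : 1 <= n%:R ^+ (4 * C) * G.
      by rewrite -[leLHS]mulr1 ler_pM // exprn_ege1.
    have size_le : (input_size (encode_kmeans P 2))%:R ^+ C <=
        (6 ^ C)%:R * n%:R ^+ (4 * C) :> R.
      have -> : (6 ^ C)%:R * n%:R ^+ (4 * C) = (6 * n ^ 4)%:R ^+ C :> R.
        by rewrite natrM natrX exprMn exprM natrX.
      rewrite lerXn2r ?nnegrE // ler_nat.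
      exact: input_size_graph_kmeans.
    have : t%:R <= C%:R * ((6 ^ C)%:R * n%:R ^+ (4 * C)) * G.
      apply: (le_trans tT); apply: le_trans (_ : C%:R *
        (input_size (encode_kmeans P 2))%:R ^+ C * G <= _).
        by rewrite ler_wpM2l ?mulr_ge0 ?exprn_ge0 // hT.
      by rewrite ler_wpM2r ?powR_ge0 // ler_wpM2l.
    rewrite -natr1 natrD natrM; lra.
  have -> : (K * n ^ 4 * t.+1)%:R = K%:R * n%:R ^+ 4 * t.+1%:R :> R.
    by rewrite natrM natrM natrX.
  move: t_le; move: (C * 6 ^ C + 1)%N => M t_le; rewrite exprD natrM.
  have := ler_wpM2l (_ : 0 <= K%:R * n%:R ^+ 4 :> R) t_le.
  by rewrite mulr_ge0 ?exprn_ge0 // => /(_ isT); lra.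
have {}r := runs_leq time r.
split; first exact: runs_halts_in r.
- move=> compl; suff -> : prob_output R (reduction q A) inp T' [:: 1] = 1.
    by clear; lra.
  apply: runs_prob_output r _; move: out.
  have dn' : d%:R <= n%:R :> R by rewrite ler_nat.
  have lam_gt : d%:R < (n ^ 2)%:R :> R by rewrite ltr_nat (leq_ltn_trans dn) // -mulnn ltn_Pmulr.
  have delta5 : delta ^+ 5 < 1 by rewrite exprn_ilt1 // ltW.
  have zeta_range : 0 < zeta < 1 / 10 by apply/andP; split=> //; lra.
  (* By the choice of [m1], [zeta * n >= 1], so [d <= n <= zeta * n ^ 2]. *)
  have d_le : d%:R <= zeta * (n ^ 2)%:R.
    rewrite (le_trans dn') // natrX expr2 mulrA ler_peMl //.
  rewrite map_graph_points in optS.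
  have [Cp' [CpE hW]] := optimal_2means_within e_simple e_reg lam_gt
    n5 d0 zeta_range d_le compl optS.
  have {}CpE : Cp' = Cp.
    by rewrite /Cp (optimal_positive_side R outA); apply/finset.setP => u; rewrite inE CpE.
  rewrite CpE in hW.
  (* From [q <= 4 / delta + 1 <= 5 / delta] the product is at most [3 * delta ^+ 4], hence at most
     3/16. *)
  have hq : 6 * zeta * q%:R <= 1.
    have q_lt' : q%:R <= 5 / delta.
      apply: (le_trans q_lt); have : 1 <= delta^-1 by rewrite invf_ge1 // ltW.
      lra.
    apply: (@le_trans _ _ (6 * (delta ^+ 5 / 10) * (5 / delta))).
      by apply: ler_pM => //; [rewrite mulr_ge0 // ltW | rewrite ler_wpM2l].
    have -> : 6 * (delta ^+ 5 / 10) * (5 / delta) = 3 * delta ^+ 4.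
      by field; rewrite gt_eqF.
    have : delta ^+ 4 <= (1 / 2) ^+ 4 by rewrite lerXn2r ?nnegrE // ltW.
    lra.
  have : (q * (within e Cp + within e (~: Cp)) <= d * n)%N.
    rewrite -(ler_nat R) !natrM natrD.
    apply: le_trans (ler_wpM2l (ler0n R q) hW) _.
    have := ler_wpM2r (_ : 0 <= d%:R * n%:R :> R) hq.
    by rewrite mulr_ge0 // => /(_ isT); lra.
  by move=> le; case: (leP _ 0) => // h; move: le h; clear; lia.
- move=> snd; suff -> : prob_output R (reduction q A) inp T' [:: 0] = 1.
    by clear; lra.
  apply: runs_prob_output r _; move: out.
  have := @soundness_within R delta n e d q Cp e_simple e_reg d0 delta0 (ltW q_gt) dltn snd.
  move=> nle; case: (leP _ 0) => // h; case: nle; move: h; clear; lia.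
Qed.

Lemma powR_exponent_mono (R : realType) (x y b beta : R) :
  1 <= x -> x <= y -> b <= beta -> b <= 1 -> x `^ (1 - beta) <= y `^ (1 - b).
Proof.
move=> x1 xy bb b1; apply: (@le_trans _ _ (x `^ (1 - b))).
  by rewrite ler_powR //; lra.
by apply: ge0_ler_powR; rewrite ?nnegrE; lra.
Qed.

Theorem corollary1p3 (R : realType) (delta zeta alpha : R) :
  0 < delta < 1 -> 0 < zeta < 1 -> 0 < alpha < 1 ->
  delta <= 10 ^- 3 -> zeta <= delta ^+ 5 / 10 -> alpha <= delta ^+ 10 ->
  XXH delta zeta alpha ->
  forall beta : R, 0 < beta ->
    ~ (exists A : cmd, solves_kmeans_in_time A (fun n k D : nat =>
         n%:R `^ ((k%:R * Num.sqrt D%:R) `^ (1 - beta)) : R))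
    /\
    ~ (exists A : cmd, solves_kmeans_in_time A (fun n k D : nat =>
         n%:R `^ (D%:R `^ (1 - beta)) : R)).
Proof.
move=> /andP[delta0 _] /andP[zeta0 _] _ delta_small hzeta _ xxh beta beta0.
have delta_half : delta <= 1 / 2 by apply: (le_trans delta_small); lra.
(* Capping at 1/2 keeps [1 - b] positive even for large [beta]. Lowering [beta] only enlarges the
   time bound, as the bases of the powers are at least 1. *)
pose b : R := Num.min beta (1 / 2).
have b0 : 0 < b by rewrite lt_min beta0 /=; lra.
have b_half : b <= 1 / 2 by rewrite ge_min lexx orbT.
have b_beta : b <= beta by rewrite ge_min lexx.
have no_solver (T : nat -> nat -> nat -> R) :
    (forall n, (0 < n)%N -> T n 2 n <= n%:R `^ ((2 * n%:R) `^ (1 - b))) ->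
    ~ exists A, solves_kmeans_in_time A T.
  move=> hT [A hA]; apply: (xxh (b / 2)); first by rewrite divr_gt0.
  apply: kmeans_solver_distinguishes hT hA => //; first by rewrite delta0.
  by rewrite b0 /=; lra.
have n_ge1 n : (0 < n)%N -> 1 <= n%:R :> R by rewrite ler1n.
split; apply: no_solver => n n0; apply: ler_powR; rewrite ?n_ge1 //;
  have n1 := n_ge1 n n0.
  have sqrt1 : 1 <= Num.sqrt n%:R :> R by rewrite -[leLHS]sqrtr1; exact: ler_wsqrtr.
  have sqrt_le : Num.sqrt n%:R <= n%:R :> R.
    by rewrite -[leRHS]sqr_sqrtr // expr2 ler_peMr ?sqrtr_ge0.
  apply: powR_exponent_mono => //; lra.
apply: powR_exponent_mono => //; lra.
Qed.
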